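(* Let $n\ge2$, let $X\subseteq\mathbb{R}^n$ be open, $V\subseteq\mathbb{R}^m$, and let $F\colon X\times V\to\mathbb{R}^n$ be continuous and continuously differentiable with respect to its first argument; assume that for any $x_0\in X$ and any admissible input signal $v\in\mathcal{V}$ the solution of the initial value problem $\dot x=F(x,v)$, $x(0)=x_0$, is extendable to the entire time axis $\mathbb{R}_+$. Let, in addition, $F$ be of class $C^{1,1}$ with respect to its first argument, and let $\varphi$ denote the general solution of $\dot x=F(x,v)$. Let $t>0$, $r>0$, and let $\Omega\subseteq X$ be $r$-convex with $\Omega\neq\mathbb{R}^n$. Further assume that there are $M_1,M_2\in\mathbb{R}$ such that $$M_1\ge2\mu_+(D_1F(x,w))-\mu_-(D_1F(x,w)),$$ $$M_2\ge\limsup_{h\to0}\frac{\|D_1F(x+h,w)-D_1F(x,w)\|}{\|h\|}$$ for all $(x,w)\in\varphi([0,t],\Omega,\mathcal{V})\times V\subseteq X\times V$. Then the attainable set $\varphi(\tau,\Omega,v)$ is convex for all $\tau\in[0,t]$ and all admissible input signals $v\in\mathcal{V}$ if $$rM_2\int_0^t\exp(M_1\rho)\,d\rho\le1.$$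
   Context: Admissible inputs: a sampling period $T>0$ and a set $U$ of piecewise continuous maps $[0,T]\to V$ are given. $\mathcal{V}$ is the set of admissible input signals, i.e. of all maps $v\colon\mathbb{R}_+\to V$ for which there is a sequence $u\colon\mathbb{Z}_+\to U$ with $v(t)=u_k(t-kT)$ for all $k\in\mathbb{Z}_+$ and all $t\in[kT,(k+1)T[$. Here $\mathbb{R}_+=[0,\infty[$ and $\mathbb{Z}_+=\{0,1,2,\dots\}$. The general solution $\varphi$ of $\dot x=F(x,v)$: $\varphi(t,x_0,v)$ is the value at time $t$ of the ($X$-valued) solution of $\dot x(t)=F(x(t),v(t))$, $x(0)=x_0$. Set arguments are pointwise: $\varphi(\tau,\Omega,v)=\{\varphi(\tau,x,v):x\in\Omega\}$, $\varphi([0,t],\Omega,\mathcal{V})=\{\varphi(\tau,x,v):\tau\in[0,t],x\in\Omega,v\in\mathcal{V}\}$. $D_1F$ is the partial derivative with respect to the first argument; $F$ continuously differentiable with respect to its first argument means that $D_1F$ exists and is continuous on $X\times V$. $C^{1,1}$ is the class of $C^1$ maps with locally Lipschitz continuous derivative. $\|\cdot\|$ is the Euclidean norm of vectors and the induced norm of linear maps. $\mu_+(A)$ and $\mu_-(A)$ are the maximum and minimum eigenvalues of the symmetric part $(A+A^* )/2$ of $A$. A set $\Omega\subseteq\mathbb{R}^n$ is $r$-convex ($r>0$) if it is the intersection of a family of closed Euclidean balls of radius $r$. *)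

(* Defs.v *)
From HB Require Import structures.
From mathcomp Require Import all_boot all_order all_algebra.
From mathcomp Require Import all_classical all_reals all_analysis.
Import Order.TTheory GRing.Theory Num.Theory.
Import numFieldNormedType.Exports.

Set Implicit Arguments.
Unset Strict Implicit.
Unset Printing Implicit Defensive.

Local Open Scope classical_set_scope.
Local Open Scope ring_scope.

(* Points of R^n are row vectors, and a matrix A stands for the linear map
   h |-> h *m A, as for [jacobian] in the library.  The library norm of
   ['rV[R]_n] and ['M[R]_n] is the max norm: it is used below only through the
   topology it induces and through local Lipschitz continuity, neither of which
   depends on the choice of the norm. *)

Definition enorm {R : realType} {n : nat} (x : 'rV[R]_n) : R :=
  Num.sqrt (\sum_i x 0 i ^+ 2).

Definition opnorm {R : realType} {n : nat} (A : 'M[R]_n) : R :=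
  sup [set enorm (h *m A) | h in [set h : 'rV[R]_n | enorm h <= 1]].

Definition sympart {R : realType} {n : nat} (A : 'M[R]_n) : 'M[R]_n :=
  2^-1 *: (A + A^T).

(* The spectrum of a symmetric real matrix is finite, and nonempty as soon as
   n > 0, so that this [sup] and this [inf] are a maximum and a minimum. *)
Definition mu_max {R : realType} {n : nat} (A : 'M[R]_n) : R :=
  sup [set a | eigenvalue (sympart A) a].

Definition mu_min {R : realType} {n : nat} (A : 'M[R]_n) : R :=
  inf [set a | eigenvalue (sympart A) a].

Definition eball {R : realType} {n : nat} (c : 'rV[R]_n) (r : R)
    : set 'rV[R]_n :=
  [set x | enorm (x - c) <= r].

(* The empty family is allowed: its intersection is the whole space. *)
Definition r_convex {R : realType} {n : nat} (r : R) (A : set 'rV[R]_n) : Prop :=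
  exists C : set 'rV[R]_n, A = \bigcap_(c in C) eball c r.

(* Maps defined on subsets are represented by total functions, whose values
   outside of these subsets are irrelevant: [0, T] for u, R_+ for input signals
   and solutions, X x V (X open) for F. *)

(* As u is a map into V, its one-sided limits are required to exist in V. *)
Definition piecewise_continuous {R : realType} {m : nat} (T : R)
    (V : set 'rV[R]_m) (u : R -> 'rV[R]_m) : Prop :=
  [/\ forall s : R, 0 <= s <= T -> V (u s),
      finite_set [set s : R | 0 < s < T /\ ~ continuous_at s u],
      forall s : R, 0 <= s < T -> exists2 l, V l & u x @[x --> s^'+] --> l &
      forall s : R, 0 < s <= T -> exists2 l, V l & u x @[x --> s^'-] --> l].

Definition admissible {R : realType} {m : nat} (T : R)
    (U : set (R -> 'rV[R]_m)) : set (R -> 'rV[R]_m) :=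
  [set v | exists u : nat -> R -> 'rV[R]_m, (forall k, U (u k)) /\
    forall k s, k%:R * T <= s < k.+1%:R * T -> v s = u k (s - k%:R * T)].

(* Solutions on R_+ for piecewise continuous v: continuous, X-valued, and
   satisfying the differential equation wherever v is continuous. *)
Definition is_solution {R : realType} {n m : nat} (X : set 'rV[R]_n)
    (F : 'rV[R]_n -> 'rV[R]_m -> 'rV[R]_n) (x0 : 'rV[R]_n)
    (v : R -> 'rV[R]_m) (x : R -> 'rV[R]_n) : Prop :=
  [/\ x 0 = x0,
      forall s : R, 0 <= s -> X (x s),
      {within `[0, +oo[, continuous x} &
      forall s : R, 0 < s -> continuous_at s v ->
        is_derive s (1 : R) x (F (x s) (v s))].

(* For x0 and v such that a solution on R_+ exists; it is unique on R_+ for the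
   F and v considered here, since F is C^1 in its first argument. *)
Definition general_solution {R : realType} {n m : nat} (X : set 'rV[R]_n)
    (F : 'rV[R]_n -> 'rV[R]_m -> 'rV[R]_n) (t : R) (x0 : 'rV[R]_n)
    (v : R -> 'rV[R]_m) : 'rV[R]_n :=
  xget (cst 0) [set x | is_solution X F x0 v x] t.

Definition attainable_tube {R : realType} {n m : nat}
    (phi : R -> 'rV[R]_n -> (R -> 'rV[R]_m) -> 'rV[R]_n) (t : R)
    (Omega : set 'rV[R]_n) (Vad : set (R -> 'rV[R]_m)) : set 'rV[R]_n :=
  [set y | exists tau x v,
    [/\ 0 <= tau <= t, Omega x, Vad v & y = phi tau x v]].

Definition D1 {R : realType} {n m : nat}
    (F : 'rV[R]_n -> 'rV[R]_m -> 'rV[R]_n) (x : 'rV[R]_n) (w : 'rV[R]_m)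
    : 'M[R]_n :=
  jacobian (F^~ w) x.

Definition C1_fst {R : realType} {n m : nat} (X : set 'rV[R]_n)
    (V : set 'rV[R]_m) (F : 'rV[R]_n -> 'rV[R]_m -> 'rV[R]_n) : Prop :=
  (forall x w, X x -> V w -> differentiable (F^~ w) x) /\
  {within X `*` V, continuous (fun p => D1 F p.1 p.2)}.

(* To be used together with [C1_fst]: for every w in V, the map F(., w) has a
   locally Lipschitz continuous derivative on X. *)
Definition D1_loc_lipschitz {R : realType} {n m : nat} (X : set 'rV[R]_n)
    (V : set 'rV[R]_m) (F : 'rV[R]_n -> 'rV[R]_m -> 'rV[R]_n) : Prop :=
  forall w, V w -> forall x, X x ->
    exists2 N, nbhs x N & [lipschitz D1 F y w | y in N `&` X].

(* limsup_{h -> 0} || D1 F (x + h, w) - D1 F (x, w) || / || h || *)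
Definition D1_limsup {R : realType} {n m : nat}
    (F : 'rV[R]_n -> 'rV[R]_m -> 'rV[R]_n) (x : 'rV[R]_n) (w : 'rV[R]_m)
    : \bar R :=
  limf_esup (fun h : 'rV[R]_n =>
    (opnorm (D1 F (x + h) w - D1 F x w) / enorm h)%:E) (0 : 'rV[R]_n)^'.

(* Main.v *)
Require Import Defs.
From HB Require Import structures.
From mathcomp Require Import all_boot all_order all_algebra.
From mathcomp Require Import all_classical all_reals all_analysis.
From mathcomp Require Import ring lra.
Import Order.TTheory GRing.Theory Num.Theory.
Import numFieldNormedType.Exports.

Set Implicit Arguments.
Unset Strict Implicit.
Unset Printing Implicit Defensive.

Local Open Scope classical_set_scope.
Local Open Scope ring_scope.

(** Fix an input v and a time tau, and let Phi be the flow map which sends an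
    initial point to the value at time tau. The theorem says that Phi maps the
    r-convex set Omega onto a convex set. Infinitesimally, the preimage under
    Phi of a straight line is a curve c satisfying
      Phi'(c) c'' = - Phi''(c)(c', c'),
    and the variation of constants formula bounds the norm of
    Phi'(c)^-1 Phi''(c)(c', c') by
      M2 * (integral of exp (M1 rho) from 0 to t) * |c'|^2,
    hence |c''| by |c'|^2 / r. Inside a ball of radius r around p the function
    |c - p|^2 is then convex, so such a curve cannot leave a ball of radius r
    that contains its endpoints, as long as it stays close to Omega.

    As D1 F is only Lipschitz continuous, second derivatives are replaced by
    second differences. If z1, x, z2 are mapped by Phi to three equidistant
    points of a line, the trajectories satisfy q(tau) = 0, where
    q = xi z1 + xi z2 - 2 xi x, and [three_point_estimate] bounds q(0) by
    (1 / (2 r) + o(1)) times S(0), where S = |xi z1 - xi x|^2 + |xi z2 - xi x|^2.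
    The quotient Z = |q| / S satisfies Z' >= - (M1 + o(1)) Z - M2 / 2, because
    |q| grows at least at the rate mu_- up to the Taylor remainder and S grows
    at most at the rate 2 mu_+ ([ratio_estimate]); this replaces the variation
    of constants formula and needs no linearised flow. The Taylor remainder is
    controlled by M2 on whole balls around the trajectory of an interior point
    of Omega, since these balls are contained in the tube: the flow is open
    ([covers_all]), a fact proved by composing short time steps, each of which
    is a Lipschitz perturbation of the identity.

    Convexity then follows in [image_convex]. The set Omega is shrunk by a
    factor l < 1 towards an interior point, which leaves room around it inside
    Omega and makes the curvature condition strict. For x0, x1 in the shrunk set
    let x1 move away from x0 along a segment. The set of positions for which
    the chord from Phi x0 to the moving endpoint lies in the image of the
    shrunk set is closed by compactness, and it is open: nearby chords have
    preimages in Omega by openness of Phi, and the maximum of the distance to a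
    centre along such a preimage cannot be interior, by the three-point
    estimate ([chord_preimage_in_ball]). Finally l tends to 1. *)

(** * Real induction and monotonicity *)

Section RealLine.
Context {R : realType}.

Lemma continuous_epsilon_delta (f : R -> R) s : {for s, continuous f} ->
  forall e, 0 < e -> exists2 d, 0 < d &
    forall u, `|u - s| < d -> `|f u - f s| < e.
Proof.
move=> cf e e0; have /cvgrPdist_lt/(_ e e0)/nbhs_ballP[d /= d0 H] := cf.
by exists d => // u us; rewrite distrC; apply: H; rewrite /ball/= distrC.
Qed.

(** The supremum of the points up to which [P] holds satisfies [P] by the
    last hypothesis, so by the second one it cannot be smaller than [b]. *)
Lemma real_induction (P : R -> Prop) (a b : R) :
    P a ->
    (forall s, a <= s < b -> P s ->
      exists2 d, 0 < d & forall u, s < u < s + d -> u <= b -> P u) ->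
    (forall s, a < s <= b -> (forall u, a <= u < s -> P u) -> P s) ->
  forall s, a <= s <= b -> P s.
Proof.
move=> Pa Pr Pl s /andP[as_ sb].
pose A := [set x | a <= x <= b /\ forall u, a <= u <= x -> P u].
have ab : a <= b by exact: le_trans sb.
have Aa : A a.
  split; first by rewrite lexx ab.
  by move=> u /andP[au ua]; rewrite (_ : u = a) //; apply: le_anti; rewrite au ua.
have ubA : ubound A b by move=> x [/andP[]].
have supA : has_sup A by split; [exists a | exists b].
set c := sup A.
have ac : a <= c by apply: ub_le_sup Aa; exists b.
have cb : c <= b by apply: ge_sup => //; exists a.
have Pltc u : a <= u < c -> P u.
  move=> /andP[au uc]; have := sup_adherent (_ : 0 < c - u) supA.
  rewrite subr_gt0 => /(_ uc)[x [_ Ax] ux]; apply: Ax.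
  by rewrite au ltW//; move: ux; rewrite -/c subKr.
have Pc : P c.
  by move: ac; rewrite le_eqVlt => /predU1P[<-//|ac]; apply: Pl; rewrite ?ac.
have Plec u : a <= u <= c -> P u.
  move=> /andP[au]; rewrite le_eqVlt => /predU1P[->//|uc].
  by apply: Pltc; rewrite au.
have [bc|cltb] := leP b c; first by apply: Plec; rewrite as_ (le_trans sb).
have [|d d0 Hd] := Pr c _ Pc; first by rewrite ac.
pose x := Num.min b (c + d / 2).
have cx : c < x by rewrite lt_min cltb ltrDl divr_gt0.
have : A x.
  split; first by rewrite (le_trans ac (ltW cx)) ge_min lexx.
  move=> u /andP[au ux]; have [uc|cu] := leP u c; first by apply: Plec; rewrite au.
  apply: Hd; last by rewrite (le_trans ux)// ge_min lexx.
  rewrite cu /= (le_lt_trans ux)// gt_min; apply/orP; right.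
  by rewrite ltrD2l ltr_pdivrMr// ltr_pMr// ltr1n.
move=> /(ub_le_sup (ex_intro _ b ubA)); rewrite -/c.
by rewrite leNgt cx.
Qed.

(** The lower right Dini derivative of [f] at [s] is nonnegative. *)
Definition right_dini_ge0 (f : R -> R) (s : R) : Prop :=
  forall e, 0 < e -> exists2 d, 0 < d &
    forall u, s < u < s + d -> f s - e * (u - s) <= f u.

(** The slack [e] at the left endpoint lets continuity start the induction
    there, where nothing is assumed on the Dini derivative. *)
Lemma le_of_right_dini_ge0 (f : R -> R) (a b : R) : a <= b ->
    (forall s, a <= s <= b -> {for s, continuous f}) ->
    (forall s, a < s < b -> right_dini_ge0 f s) ->
  f a <= f b.
Proof.
move=> ab cf df; apply/ler_addgt0Pr => e0 e0_gt0.
pose e := e0 / (1 + (b - a)).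
have ba : 0 < 1 + (b - a) by rewrite ltr_wpDr// subr_ge0.
have e_gt0 : 0 < e by rewrite divr_gt0.
suff H : forall s, a <= s <= b -> f a - e - e * (s - a) <= f s.
  have := H b; rewrite lexx ab => /(_ isT).
  by rewrite -addrA -opprD -{1}[e]mulr1 -mulrDr /e divfK ?gt_eqF// lerBlDr.
apply: real_induction.
- by rewrite subrr mulr0 subr0 gerBl ltW.
- move=> s /andP[as_ sb] Hs; move: as_; rewrite le_eqVlt => /predU1P[ea|as_].
    subst s.
    have [|d d0 Hd] := continuous_epsilon_delta (cf a _) e_gt0.
      by rewrite lexx.
    exists d => // u /andP[au ud] _.
    have /Hd : `|u - a| < d by rewrite gtr0_norm ?subr_gt0// ltrBlDl.
    rewrite ltr_norml => /andP[h _].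
    have : 0 <= e * (u - a) by rewrite mulr_ge0 ?subr_ge0 ?ltW.
    lra.
  have [|d d0 Hd] := df s _ e e_gt0; first by rewrite as_.
  exists d => // u su _; have := Hd u su; lra.
- move=> s /andP[as_ sb] Hs.
  apply/ler_addgt0Pr => x x0.
  have [|d d0 Hd] := continuous_epsilon_delta (cf s _) x0.
    by rewrite sb ltW.
  pose u := Num.max a (s - d / 2).
  have d2 : 0 < d / 2 by rewrite divr_gt0.
  have us : u < s by rewrite gt_max as_ ltrBlDr ltrDl.
  have au : a <= u by rewrite le_max lexx.
  have du : s - d / 2 <= u by rewrite le_max lexx orbT.
  have /Hd : `|u - s| < d.
    rewrite ltr0_norm ?subr_lt0// opprB.
    by have := d0; lra.
  rewrite ltr_norml => /andP[h h'].
  have := Hs u; rewrite us au => /(_ isT).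
  have : 0 <= e * (s - u) by rewrite mulr_ge0 ?subr_ge0 ?ltW.
  by lra.
Qed.

(** The exceptional points cut the interval into finitely many pieces. This
    form is needed since inputs, hence derivatives of trajectories, may jump. *)
Lemma le_of_right_dini_ge0_except (E : set R) (f : R -> R) (a b : R) :
    finite_set E -> a <= b ->
    (forall s, a <= s <= b -> {for s, continuous f}) ->
    (forall s, a < s < b -> ~ E s -> right_dini_ge0 f s) ->
  f a <= f b.
Proof.
move=> /finite_seqP[l ->] {E}; elim: l a b => [|e l IH] a b ab cf df.
  by apply: le_of_right_dini_ge0 => // s sab; apply: df.
have [|eab] := boolP (a < e < b); last first.
  apply: IH => // s sab sl; apply: df => //= /[!inE] /predU1P[es|//].
  by move: eab; rewrite -es sab.
move=> /andP[ae eb]; apply: (@le_trans _ _ (f e)); apply: IH => //; try exact: ltW.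
- by move=> s /andP[h1 h2]; apply: cf; rewrite h1 (le_trans h2)// ltW.
- move=> s /andP[h1 h2] sl; apply: df; first by rewrite h1 (lt_trans h2).
  by rewrite /= inE => /predU1P[es|//]; move: h2; rewrite es ltxx.
- by move=> s /andP[h1 h2]; apply: cf; rewrite h2 (le_trans _ h1)// ltW.
- move=> s /andP[h1 h2] sl; apply: df; first by rewrite h2 (lt_trans _ h1).
  by rewrite /= inE => /predU1P[es|//]; move: h1; rewrite es ltxx.
Qed.

Lemma derive_ge0_right_dini (f : R -> R) (s df : R) :
  is_derive s (1 : R) f df -> 0 <= df -> right_dini_ge0 f s.
Proof.
move=> fD df0 e e0.
case: fD => fd dfE; have : h^-1 *: (f (h *: 1 + s) - f s) @[h --> 0^'] --> df.
  by rewrite -dfE; exact: fd.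
move/cvgrPdist_lt => /(_ e e0)/nbhs_ballP[d /= d0 H].
exists d => // u /andP[su ud].
have us : 0 < u - s by rewrite subr_gt0.
have := H (u - s); rewrite /ball/= sub0r normrN gtr0_norm//.
rewrite ltrBlDl ud => /(_ isT); rewrite gt_eqF// => /(_ isT).
rewrite [_%:A]mulr1 subrK ltr_norml => /andP[_].
rewrite ltrBlDr => h.
suff : - (e * (u - s)) <= f u - f s by lra.
rewrite -mulNr -ler_pdivlMr//.
by move: h; rewrite /GRing.scale/= mulrC; lra.
Qed.

Lemma is_derive_continuous (f : R -> R) (s df : R) :
  is_derive s (1 : R) f df -> {for s, continuous f}.
Proof. by case=> /derivable1_diffP/differentiable_continuous. Qed.

Lemma le_of_derive_ge0_except (E : set R) (f : R -> R) (df : R -> R) (a b : R) :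
    finite_set E -> a <= b ->
    (forall s, a <= s <= b -> {for s, continuous f}) ->
    (forall s, a < s < b -> ~ E s -> is_derive s (1 : R) f (df s)) ->
    (forall s, a < s < b -> ~ E s -> 0 <= df s) ->
  f a <= f b.
Proof.
move=> Efin ab cf fD df0; apply: le_of_right_dini_ge0_except Efin ab cf _.
move=> s sab nEs; exact: derive_ge0_right_dini (fD s sab nEs) (df0 s sab nEs).
Qed.

End RealLine.

(** * Euclidean geometry of row vectors *)

Section Euclid.
Context {R : realType} {n : nat}.
Implicit Types (x y z : 'rV[R]_n) (a r : R).

Definition dot x y : R := \sum_i x 0 i * y 0 i.

Lemma dotC x y : dot x y = dot y x.
Proof. by apply: eq_bigr => i _; rewrite mulrC. Qed.

Lemma dotDl x y z : dot (x + y) z = dot x z + dot y z.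
Proof. by rewrite -big_split/=; apply: eq_bigr => i _; rewrite mxE mulrDl. Qed.

Lemma dotZl a x y : dot (a *: x) y = a * dot x y.
Proof. by rewrite mulr_sumr; apply: eq_bigr => i _; rewrite mxE mulrA. Qed.

Lemma dotNl x y : dot (- x) y = - dot x y.
Proof. by rewrite -scaleN1r dotZl mulN1r. Qed.

Lemma dotDr x y z : dot z (x + y) = dot z x + dot z y.
Proof. by rewrite !(dotC z) dotDl. Qed.

Lemma dotZr a x y : dot y (a *: x) = a * dot y x.
Proof. by rewrite !(dotC y) dotZl. Qed.

Lemma dotNr x y : dot y (- x) = - dot y x.
Proof. by rewrite !(dotC y) dotNl. Qed.

Lemma dot0l x : dot 0 x = 0.
Proof. by rewrite -(scale0r 0) dotZl mul0r. Qed.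

Lemma dot0r x : dot x 0 = 0.
Proof. by rewrite dotC dot0l. Qed.

Definition dotE := (dotDl, dotDr, dotZl, dotZr, dotNl, dotNr, dot0l, dot0r).

Lemma dot_sqrD x y : dot (x + y) (x + y) = dot x x + 2 * dot x y + dot y y.
Proof. by rewrite !dotE (dotC y x); ring. Qed.

Lemma dot_sqrB x y : dot (x - y) (x - y) = dot x x - 2 * dot x y + dot y y.
Proof. by rewrite !dotE (dotC y x); ring. Qed.

Lemma dot_ge0 x : 0 <= dot x x.
Proof. by apply: sumr_ge0 => i _; rewrite -expr2 sqr_ge0. Qed.

Lemma sqr_coord_le_dot x i : x 0 i ^+ 2 <= dot x x.
Proof.
rewrite /dot (bigD1 i)//= -expr2 lerDl; apply: sumr_ge0 => j _.
by rewrite -expr2 sqr_ge0.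
Qed.

Lemma dot_eq0 x : dot x x = 0 -> x = 0.
Proof.
move=> x0; apply/rowP => i; rewrite mxE; apply/eqP.
by rewrite -sqrf_eq0 eq_le sqr_ge0 -x0 sqr_coord_le_dot.
Qed.

Lemma dot_gt0 x : x != 0 -> 0 < dot x x.
Proof. by rewrite lt0r dot_ge0 andbT; apply: contraNneq => /dot_eq0 ->. Qed.

Lemma enormE x : enorm x = Num.sqrt (dot x x).
Proof. by congr Num.sqrt; apply: eq_bigr => i _; rewrite expr2. Qed.

Lemma enorm_sqr x : enorm x ^+ 2 = dot x x.
Proof. by rewrite enormE sqr_sqrtr// dot_ge0. Qed.

Lemma enorm_ge0 x : 0 <= enorm x.
Proof. by rewrite enormE sqrtr_ge0. Qed.

Lemma enorm0 : enorm (0 : 'rV[R]_n) = 0.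
Proof. by rewrite enormE dot0l sqrtr0. Qed.

Lemma enorm_eq0 x : enorm x = 0 -> x = 0.
Proof. by move=> x0; apply: dot_eq0; rewrite -enorm_sqr x0 expr0n. Qed.

Lemma enorm_gt0 x : x != 0 -> 0 < enorm x.
Proof. by rewrite lt0r enorm_ge0 andbT; apply: contraNneq => /enorm_eq0 ->. Qed.

Lemma enormZ a x : enorm (a *: x) = `|a| * enorm x.
Proof.
by rewrite !enormE !dotE mulrA -expr2 sqrtrM ?sqr_ge0// sqrtr_sqr.
Qed.

Lemma enormN x : enorm (- x) = enorm x.
Proof. by rewrite !enormE !dotE opprK. Qed.

Lemma enormC x y : enorm (x - y) = enorm (y - x).
Proof. by rewrite -enormN opprB. Qed.

Lemma enorm_le_sqr x a : 0 <= a -> (enorm x <= a) = (dot x x <= a ^+ 2).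
Proof.
by move=> a0; rewrite -enorm_sqr ler_pXn2r ?nnegrE// enorm_ge0.
Qed.

Lemma cauchy_schwarz_sqr x y : dot x y ^+ 2 <= dot x x * dot y y.
Proof.
have [->|/dot_gt0 y0] := eqVneq y 0; first by rewrite !dotE expr0n mulr0.
have := dot_ge0 (dot y y *: x - dot x y *: y); rewrite !dotE (dotC y x).
rewrite (_ : _ + _ = dot y y * (dot x x * dot y y - dot x y ^+ 2)); last by ring.
by rewrite pmulr_rge0// subr_ge0.
Qed.

Lemma cauchy_schwarz x y : dot x y <= enorm x * enorm y.
Proof.
have [d0|/ltW d0] := leP (dot x y) 0.
  by apply: le_trans d0 _; rewrite mulr_ge0 ?enorm_ge0.
rewrite -(@ler_pXn2r _ 2) ?nnegrE// ?mulr_ge0 ?enorm_ge0//.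
by rewrite exprMn !enorm_sqr cauchy_schwarz_sqr.
Qed.

Lemma enormD x y : enorm (x + y) <= enorm x + enorm y.
Proof.
rewrite enorm_le_sqr ?addr_ge0 ?enorm_ge0// !dotE (dotC y x) sqrrD !enorm_sqr.
have := cauchy_schwarz x y; lra.
Qed.

Lemma enorm_triangle z x y : enorm (x - y) <= enorm (x - z) + enorm (z - y).
Proof. by have := enormD (x - z) (z - y); rewrite addrA subrK. Qed.

(** Reduces estimates on vectors to estimates on scalar functions. *)
Lemma enorm_dual x a : 0 <= a -> (forall y, dot y x <= enorm y * a) ->
  enorm x <= a.
Proof.
move=> a0 /(_ x); rewrite -enorm_sqr expr2.
have := enorm_ge0 x; rewrite le_eqVlt => /predU1P[<-//|x0].
by rewrite ler_pM2l.
Qed.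

Lemma norm_le_enorm x : `|x| <= enorm x.
Proof.
rewrite [leLHS]/Num.Def.normr/= mx_normrE; apply: bigmax_le => [|[i j] _].
  exact: enorm_ge0.
rewrite /= (ord1 i) -(@ler_pXn2r _ 2) ?nnegrE ?enorm_ge0// enorm_sqr.
by rewrite real_normK ?num_real// sqr_coord_le_dot.
Qed.

Lemma coord_le_norm m p (A : 'M[R]_(m, p)) i j : `|A i j| <= `|A|.
Proof.
rewrite [leRHS]/Num.Def.normr/= mx_normrE.
exact: (le_bigmax _ (fun k => `|A k.1 k.2|) (i, j)).
Qed.

Lemma enorm_le_norm x : enorm x <= n%:R * `|x|.
Proof.
case: (posnP n) => [n0|n0].
  suff -> : x = 0 by rewrite enorm0 normr0 mulr0.
  by apply/rowP => i; have := ltn_ord i; rewrite [X in (_ < X)%N]n0.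
rewrite enorm_le_sqr ?mulr_ge0// exprMn.
apply: (@le_trans _ _ (\sum_(i < n) `|x| ^+ 2)).
  apply: ler_sum => i _; rewrite -expr2 -[leLHS]real_normK ?num_real//.
  by rewrite ler_pXn2r ?nnegrE// coord_le_norm.
rewrite sumr_const card_ord -[leLHS]mulr_natl ler_wpM2r// ?exprn_ge0//.
by rewrite expr2 ler_peMl// ler1n.
Qed.

(** The max norm and the Euclidean norm are equivalent, so the topology can be
    handled with Euclidean balls. *)
Lemma nbhs_enormP x (A : set 'rV[R]_n) :
  nbhs x A <-> exists2 e, 0 < e & forall y, enorm (y - x) < e -> A y.
Proof.
split=> [/nbhs_ballP[e /= e0 xA]|[e e0 xA]].
  exists e => // y yx; apply: xA.
  by rewrite -ball_normE/= distrC (le_lt_trans (norm_le_enorm _)).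
have ne : 0 < n%:R + 1 :> R by rewrite ltr_wpDl.
apply/nbhs_ballP; exists (e / (n%:R + 1)) => /=; first by rewrite divr_gt0.
move=> y; rewrite -ball_normE/= distrC ltr_pdivlMr// => yx; apply: xA.
apply: le_lt_trans yx; apply: le_trans (enorm_le_norm _) _.
by rewrite mulrC ler_wpM2l// lerDl.
Qed.

Lemma continuous_enormP (T : topologicalType) (f : T -> 'rV[R]_n) (p : T) :
  {for p, continuous f} <->
  (forall e, 0 < e -> \forall q \near p, enorm (f q - f p) < e).
Proof.
split=> [cf e e0|cf].
  by apply: (cf (fun y => enorm (y - f p) < e)); apply/nbhs_enormP; exists e.
move=> A /nbhs_enormP[e e0 xA]; have := cf e e0.
by apply: filterS => q; exact: xA.
Qed.

Lemma continuous_affine (a : R) (b c : 'rV[R]_n) :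
  continuous (fun x : 'rV[R]_n => b + a *: (x - c)).
Proof.
move=> p; apply/continuous_enormP => e e0; apply/nbhs_enormP.
have a0 : 0 < `|a| + 1 by rewrite ltr_wpDl.
exists (e / (`|a| + 1)); first by rewrite divr_gt0.
move=> y; rewrite ltr_pdivlMr// => yp.
rewrite (_ : _ - _ = a *: (y - p)); last by apply/rowP => i; rewrite !mxE; ring.
rewrite enormZ mulrC; apply: le_lt_trans yp.
by rewrite ler_wpM2l ?enorm_ge0// lerDl.
Qed.

Lemma continuous_translate (c : 'rV[R]_n) :
  continuous (fun x : 'rV[R]_n => x - c).
Proof.
have := @continuous_affine 1 0 c.
by under [X in continuous X]funext => x do rewrite add0r scale1r.
Qed.

Lemma continuous_line (a p : 'rV[R]_n) : continuous (fun s : R => a + s *: p).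
Proof.
by move=> s; apply: cvgD; [exact: cvg_cst | apply: cvgZr_tmp; exact: cvg_id].
Qed.

Lemma enorm_continuous : continuous (@enorm R n).
Proof.
move=> x A /nbhs_ballP[e /= e0 xA]; apply/nbhs_enormP; exists e => // y yx.
apply: xA; rewrite /ball/= distrC ltr_norml; apply/andP; split.
  by have := enormD y (x - y); rewrite addrC subrK enormC; lra.
by have := enormD x (y - x); rewrite addrC subrK; lra.
Qed.

Lemma closed_eball (c : 'rV[R]_n) (a : R) : closed (eball c a).
Proof.
rewrite (_ : eball c a = (fun x => enorm (x - c)) @^-1` [set b | b <= a])//.
apply: closed_comp (@closed_le _ a) => x _.
have cB : {for x, continuous (fun y : 'rV[R]_n => y - c)}.
  exact: continuous_translate.
exact: (continuous_comp cB (@enorm_continuous _)).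
Qed.

Lemma compact_eball (c : 'rV[R]_n) (a : R) : compact (eball c a).
Proof.
apply: bounded_closed_compact; last exact: closed_eball.
exists (`|c| + a); split; first exact: num_real.
move=> M Ma x /= xc; apply: le_trans (ltW Ma).
rewrite -lerBlDl; apply: le_trans (lerB_dist _ _) _.
exact: le_trans (norm_le_enorm _) xc.
Qed.

Lemma continuous_big_sum (T : topologicalType) m (h : 'I_m -> T -> R) (p : T) :
  (forall i, {for p, continuous (h i)}) ->
  {for p, continuous (fun q => \sum_i h i q)}.
Proof.
move=> ch; rewrite (_ : (fun q => _) = \sum_i h i); last first.
  by apply/funext => q; rewrite fct_sumE.
by elim/big_ind: _ => //; [exact: cst_continuous|move=> f g; exact: continuousD].
Qed.

Lemma continuous_dot (T : topologicalType) (f g : T -> 'rV[R]_n) (p : T) :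
  {for p, continuous f} -> {for p, continuous g} ->
  {for p, continuous (fun q => dot (f q) (g q))}.
Proof.
move=> cf cg; apply: continuous_big_sum => i.
apply: continuousM.
  exact: (continuous_comp cf (@coord_continuous R 1 n 0 i (f p))).
exact: (continuous_comp cg (@coord_continuous R 1 n 0 i (g p))).
Qed.

Lemma is_derive_coord (f : R -> 'rV[R]_n) (s : R) df i :
  is_derive s (1 : R) f df -> is_derive s (1 : R) (fun u => f u 0 i) (df 0 i).
Proof.
case=> fd <-; split; first by have /derivable_mxP := fd; exact.
by rewrite derive_mx// mxE.
Qed.

Lemma is_derive_dot (f g : R -> 'rV[R]_n) (s : R) df dg :
  is_derive s (1 : R) f df -> is_derive s (1 : R) g dg ->
  is_derive s (1 : R) (fun u => dot (f u) (g u)) (dot (f s) dg + dot df (g s)).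
Proof.
move=> fD gD; rewrite (_ : (fun u => _) =
    \sum_i ((fun u => f u 0 i) * (fun u => g u 0 i))); last first.
  by apply/funext => u; rewrite fct_sumE.
rewrite -big_split/=; apply: is_derive_sum => i.
have fDi := is_derive_coord i fD; have gDi := is_derive_coord i gD.
apply: is_derive_eq (is_deriveM fDi gDi) _.
by rewrite /GRing.scale/=; ring.
Qed.

End Euclid.

(** * Convex images of intersections of balls *)

(** The hypotheses on [Phi] are those satisfied by the flow map at a fixed
    time; [Phi_curv] is the curvature condition in terms of second differences,
    with a factor [K] that may be taken arbitrarily close to 1. *)
Section ConvexImage.
Context {R : realType} {n : nat}.
Implicit Types x y z : 'rV[R]_n.
Context (r : R) (C : set 'rV[R]_n) (Phi : 'rV[R]_n -> 'rV[R]_n).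
Let Omega := \bigcap_(c in C) eball c r.
Context (r_gt0 : 0 < r) (C_neq0 : C !=set0).
Context (Phi_cont : forall x, Omega x -> {for x, continuous Phi}).
Context (Phi_inj : forall x y, Omega x -> Omega y -> Phi x = Phi y -> x = y).
Context (Phi_open : forall x, Omega x -> forall e : R, 0 < e ->
  exists2 d : R, 0 < d & forall y, enorm (y - Phi x) < d ->
    exists2 z, enorm (z - x) < e & Phi z = y).
Context (Phi_curv : forall x, nbhs x Omega -> forall K : R, 1 < K ->
  exists2 d : R, 0 < d & forall z1 z2 : 'rV[R]_n,
    enorm (z1 - x) < d -> enorm (z2 - x) < d ->
    Phi z1 + Phi z2 = 2 *: Phi x ->
    enorm (z1 - x + (z2 - x)) <=
      K / (2 * r) * (dot (z1 - x) (z1 - x) + dot (z2 - x) (z2 - x))).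

Let Omega_closed : closed Omega.
Proof. by apply: closed_bigI => c _; exact: closed_eball. Qed.

Let Omega_compact : compact Omega.
Proof.
have [c Cc] := C_neq0.
by apply: subclosed_compact Omega_closed (@compact_eball _ _ c r) _ => x; exact.
Qed.

Let Phi_image_closed (A : set 'rV[R]_n) :
  compact A -> A `<=` Omega -> closed (Phi @` A).
Proof.
move=> cA AO; apply: compact_closed; first exact: norm_hausdorff.
apply: continuous_compact => //; apply: continuous_in_subspaceT => x.
by rewrite inE => /AO; exact: Phi_cont.
Qed.

(** Maximum principle. Let [z] maximise the distance to [c] on the preimage of
    the chord. If [z] were not mapped to an endpoint, the points [z1], [z2]
    mapped to [Phi z + h p] and [Phi z - h p] would be no farther from [c] than
    [z]; expanding the two squared distances, [Phi_curv] and [|z - c| < r]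
    contradict this. *)
Lemma chord_preimage_in_ball c rho x0 x1 :
    0 <= rho -> Omega x0 -> Omega x1 ->
    enorm (x0 - c) <= rho -> enorm (x1 - c) <= rho ->
    (forall s, 0 <= s <= 1 -> exists z, [/\ nbhs z Omega, enorm (z - c) < r &
      Phi z = Phi x0 + s *: (Phi x1 - Phi x0)]) ->
  forall z s, Omega z -> 0 <= s <= 1 ->
    Phi z = Phi x0 + s *: (Phi x1 - Phi x0) -> enorm (z - c) <= rho.
Proof.
move=> rho0 Ox0 Ox1 x0c x1c chord.
set p := Phi x1 - Phi x0; pose line s := Phi x0 + s *: p.
have [p0|pn0] := eqVneq p 0.
  move=> z s Oz _; rewrite p0 scaler0 addr0 => zx0.
  by rewrite (Phi_inj Oz Ox0 zx0).
pose A := Omega `&` [set z | (line @` `[0, 1]) (Phi z)].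
have line_cont : continuous line.
  exact: continuous_line.
have line_closed : closed (line @` `[0, 1]).
  apply: compact_closed; first exact: norm_hausdorff.
  apply: continuous_compact (@segment_compact _ _ _).
  exact: continuous_subspaceT.
have A_closed : closed A.
  move=> z clz; have Oz : Omega z.
    by apply: Omega_closed => B /clz [y [[Oy _] By]]; exists y.
  split => //; apply: line_closed => B PhizB.
  by have [y [[_ ly] By]] := clz _ (Phi_cont Oz PhizB); exists (Phi y).
have A_compact : compact A.
  by apply: subclosed_compact A_closed Omega_compact _ => z [].
have Ax0 : A x0.
  split=> //; exists 0; first by rewrite /= in_itv/= lexx ler01.
  by rewrite /line scale0r addr0.
pose f z := dot (z - c) (z - c).
have f_cont : continuous f.
  by move=> z; have cz := @continuous_translate R n c z; exact: (continuous_dot cz cz).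
have [//||z] := @EVT_max_rV R n f A _ A_compact.
- by exists x0.
- exact: continuous_subspaceT.
rewrite inE => -[Oz [s s01 Phiz]] fmax.
suff fz : f z <= rho ^+ 2.
  move=> y t Oy t01 Phiy; rewrite enorm_le_sqr//; apply: le_trans fz.
  by apply: fmax; rewrite inE; split=> //; exists t.
move: s01; rewrite /= in_itv/= => /andP[s0 s1].
move: s0; rewrite le_eqVlt => /predU1P[es|s0].
  have -> : z = x0 by apply: Phi_inj => //; rewrite -Phiz -es /line scale0r addr0.
  by rewrite -enorm_le_sqr.
move: s1; rewrite le_eqVlt => /predU1P[es|s1].
  have -> : z = x1.
    by apply: Phi_inj => //; rewrite -Phiz es /line scale1r addrC subrK.
  by rewrite -enorm_le_sqr.
exfalso.
have [zO zc] : nbhs z Omega /\ enorm (z - c) < r.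
  have [|z' [z'O z'c Phiz']] := chord s; first by rewrite !ltW.
  suff -> : z = z' by [].
  by apply: Phi_inj => //; [exact: nbhs_singleton z'O | rewrite Phiz' -Phiz].
set g := enorm (z - c) in zc.
have g0 : 0 <= g by exact: enorm_ge0.
have rg0 : 0 < r + g by rewrite ltr_pwDl.
(* Any K > 1 with K * g < r would do. *)
pose K := 2 * r / (r + g).
have K1 : 1 < K by rewrite ltr_pdivlMr// mul1r; lra.
have [d d0 Hd] := Phi_curv zO K1.
have [e e0 He] := (nbhs_enormP _ _).1 zO.
have de0 : 0 < Num.min d e by rewrite lt_min d0.
have [d' d'0 Hd'] := Phi_open Oz de0.
pose h := Num.min (Num.min s (1 - s)) (d' / 2 / enorm p).
have p_gt0 : 0 < enorm p by exact: enorm_gt0.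
have h0 : 0 < h by rewrite !lt_min s0 subr_gt0 s1 !divr_gt0.
have hs : h <= s by rewrite !ge_min lexx.
have hs1 : h <= 1 - s by rewrite !ge_min lexx orbT.
have hd : enorm (h *: p) < d'.
  rewrite enormZ gtr0_norm//; apply: le_lt_trans (_ : d' / 2 < _).
    by rewrite -ler_pdivlMr// /h ge_min lexx orbT.
  by lra.
have [|z1 z1z Phiz1] := Hd' (Phi z + h *: p); first by rewrite addrAC subrr add0r.
have [|z2 z2z Phiz2] := Hd' (Phi z - h *: p).
  by rewrite addrAC subrr add0r enormN.
move: z1z z2z; rewrite !lt_min => /andP[z1d z1e] /andP[z2d z2e].
have f1 : f z1 <= f z.
  apply: fmax; rewrite inE; split; first exact: He.
  exists (s + h); first by rewrite /= in_itv/=; lra.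
  by rewrite Phiz1 -Phiz /line -addrA -scalerDl.
have f2 : f z2 <= f z.
  apply: fmax; rewrite inE; split; first exact: He.
  exists (s - h); first by rewrite /= in_itv/=; lra.
  by rewrite Phiz2 -Phiz /line -addrA -scalerBl.
have := Hd z1 z2 z1d z2d; rewrite Phiz1 Phiz2 addrACA subrr addr0.
rewrite -[Phi z + _]mulr2n scaler_nat => /(_ erefl).
set u := z1 - z; set w := z2 - z; set v := z - c.
have u_gt0 : 0 < dot u u.
  apply: dot_gt0; apply: contraNneq pn0 => /eqP; rewrite subr_eq0 => /eqP z1z.
  move: Phiz1; rewrite z1z => /eqP; rewrite -subr_eq0 opprD addrA subrr sub0r.
  by rewrite oppr_eq0 scaler_eq0 gt_eqF.
set S := dot u u + dot w w => quw.
have S0 : 0 < S by rewrite ltr_pwDl// dot_ge0.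
have csuw : - dot (u + w) v <= enorm (u + w) * g.
  by rewrite -dotNl -[enorm (u + w)]enormN cauchy_schwarz.
have {}quw : enorm (u + w) * g <= K / (2 * r) * S * g by rewrite ler_wpM2r.
have Kg : K / (2 * r) * S * g = S * (g / (r + g)).
  by rewrite /K; field; rewrite !gt_eqF.
have gS : S * (g / (r + g)) < S / 2.
  by rewrite ltr_pM2l// ltr_pdivrMr//; lra.
have z1E : z1 - c = u + v by rewrite /u /v addrA subrK.
have z2E : z2 - c = w + v by rewrite /w /v addrA subrK.
move: f1 f2; rewrite /f z1E z2E -/v; rewrite (dot_sqrD u) (dot_sqrD w).
move: csuw quw gS; rewrite Kg /S (dotDl u w).
by lra.
Qed.

Section Shrinking.
Context (c0 : 'rV[R]_n) (delta l : R).
Context (delta_gt0 : 0 < delta) (l01 : 0 < l < 1).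
Context (ball_Omega : forall x, enorm (x - c0) < delta -> Omega x).

Let shrink x := c0 + l *: (x - c0).
Let Omega' := shrink @` Omega.
Let l_gt0 : 0 < l. Proof. by case/andP: l01. Qed.
Let l'_gt0 : 0 < 1 - l. Proof. by case/andP: l01; rewrite subr_gt0. Qed.

Let shrink_ball x : (forall c, C c -> enorm (x - shrink c) <= l * r) -> Omega' x.
Proof.
move=> xc; exists (c0 + l^-1 *: (x - c0)); last first.
  by rewrite /shrink addrAC subrr add0r scalerA divff ?gt_eqF// scale1r addrC subrK.
move=> c /xc; rewrite /eball/= (_ : x - shrink c =
    l *: (c0 + l^-1 *: (x - c0) - c)); last first.
  by apply/rowP => i; rewrite /shrink !mxE; field; rewrite gt_eqF.
by rewrite enormZ gtr0_norm// ler_pM2l.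
Qed.

Let N := [set y | exists2 x, Omega' x & enorm (y - x) < (1 - l) * Num.min delta r].

Let Omega_convex x y s : Omega x -> Omega y -> 0 <= s <= 1 ->
  Omega (x + s *: (y - x)).
Proof.
move=> Ox Oy /andP[s0 s1] c Cc; rewrite /eball/=.
rewrite (_ : _ - c = (1 - s) *: (x - c) + s *: (y - c)); last first.
  by apply/rowP => i; rewrite !mxE; ring.
apply: le_trans (enormD _ _) _; rewrite !enormZ !ger0_norm ?subr_ge0//.
rewrite (_ : r = (1 - s) * r + s * r); last by ring.
by apply: lerD; apply: ler_wpM2l; rewrite ?subr_ge0//; [exact: Ox|exact: Oy].
Qed.

Let Omega'_convex x y s : Omega' x -> Omega' y -> 0 <= s <= 1 ->
  Omega' (x + s *: (y - x)).
Proof.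
move=> [x' Ox <-] [y' Oy <-] s01; exists (x' + s *: (y' - x')).
  exact: Omega_convex.
by apply/rowP => i; rewrite !mxE; ring.
Qed.

Let N_Omega : N `<=` Omega.
Proof.
move=> y [_ [x Ox <-] yx].
pose u := (1 - l)^-1 *: (y - shrink x).
have Ou : Omega (c0 + u).
  apply: ball_Omega; rewrite addrAC subrr add0r enormZ gtr0_norm ?invr_gt0//.
  by rewrite mulrC ltr_pdivrMr// mulrC (lt_le_trans yx)// ler_pM2l// ge_min lexx.
have l01' : 0 <= l <= 1 by case/andP: l01 => l0 l1; rewrite !ltW.
have := Omega_convex Ou Ox l01'; rewrite (_ : c0 + u + _ = y)//.
by apply/rowP => i; rewrite /u /shrink !mxE; field; rewrite gt_eqF.
Qed.

Let N_nbhs y : N y -> nbhs y Omega.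
Proof.
move=> [x Ox yx]; apply/nbhs_enormP.
exists ((1 - l) * Num.min delta r - enorm (y - x)); first by rewrite subr_gt0.
move=> z zy; apply: N_Omega; exists x => //.
by apply: le_lt_trans (enorm_triangle y z x) _; rewrite -ltrBrDr.
Qed.

Let shrink_dist x c : Omega' x -> C c -> enorm (x - shrink c) <= l * r.
Proof.
move=> [y Oy <-] Cc.
rewrite (_ : _ - _ = l *: (y - c)); last by apply/rowP => i; rewrite !mxE; ring.
by rewrite enormZ gtr0_norm// ler_pM2l//; exact: Oy.
Qed.

Let N_dist y c : N y -> C c -> enorm (y - shrink c) < r.
Proof.
move=> [x Ox yx] Cc; have xc := shrink_dist Ox Cc.
apply: le_lt_trans (enorm_triangle x y _) _.
have : (1 - l) * Num.min delta r <= (1 - l) * r.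
  by rewrite ler_pM2l// ge_min lexx orbT.
lra.
Qed.

Let Omega'_N : Omega' `<=` N.
Proof.
by move=> x Ox; exists x => //; rewrite subrr enorm0 mulr_gt0// lt_min delta_gt0.
Qed.

Let Omega'_compact : compact Omega'.
Proof.
apply: continuous_compact => //; apply: continuous_subspaceT.
exact: continuous_affine.
Qed.

(** Real induction on the position [sigma] of the endpoint [xs sigma], which
    moves from [x0] to [x1]. Nearby chords lie in the image of [N], a
    neighbourhood of [Omega'] in [Omega], by openness of [Phi] and compactness
    of the chord; the maximum principle, applied with the centres of the balls
    of radius [l * r] whose intersection is [Omega'], brings their preimages
    back into [Omega']. *)
Lemma shrunk_image_convex x0 x1 : Omega' x0 -> Omega' x1 ->
  forall s, 0 <= s <= 1 ->
  exists2 x, Omega' x & Phi x = Phi x0 + s *: (Phi x1 - Phi x0).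
Proof.
move=> Ox0 Ox1.
pose xs sigma := x0 + sigma *: (x1 - x0).
pose G (p : R * R) := Phi x0 + p.1 *: (Phi (xs p.2) - Phi x0).
have Oxs sigma : 0 <= sigma <= 1 -> Omega' (xs sigma) by exact: Omega'_convex.
have OO x : Omega' x -> Omega x by move=> /Omega'_N/N_Omega.
have xs_cont : continuous xs.
  exact: continuous_line.
have G_cont p : 0 <= p.2 <= 1 -> {for p, continuous G}.
  move=> p2; apply: cvgD; first exact: cvg_cst.
  apply: cvgZ; first exact: cvg_fst.
  apply: cvgB; last exact: cvg_cst.
  have xs2_cont : {for p, continuous (fun q : R * R => xs q.2)}.
    by apply: continuous_comp; [exact: cvg_snd | exact: xs_cont].
  by apply: (continuous_comp xs2_cont); apply: Phi_cont; exact/OO/Oxs.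
pose P sigma := forall s, 0 <= s <= 1 -> exists2 x, Omega' x & Phi x = G (s, sigma).
suff : P 1.
  move=> P1 s /P1[x Ox xG]; exists x => //.
  by rewrite xG /G/= /xs scale1r [x0 + _]addrC subrK.
apply: (@real_induction R P 0 1); last by rewrite ler01 lexx.
- move=> s _; exists x0 => //.
  by rewrite /G/= /xs scale0r addr0 subrr scaler0 addr0.
- move=> sigma /andP[sg0 sg1] Psg.
  have sg01 : 0 <= sigma <= 1 by rewrite sg0 ltW.
  have near_N : \forall sg \near sigma, `[0, 1]%classic `<=`
      [set s | exists2 x, N x & Phi x = G (s, sg)].
    have /compact_near_coveringP cov := @segment_compact R 0 1.
    apply: (cov R (nbhs sigma) (fun sg s => exists2 x, N x & Phi x = G (s, sg))).
    move=> s; rewrite /= in_itv/= => s01.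
    have [x Ox xG] := Psg s s01.
    have [e e0 He] : exists2 e, 0 < e & forall z, enorm (z - x) < e -> N z.
      exists ((1 - l) * Num.min delta r).
        by rewrite mulr_gt0// lt_min delta_gt0.
      by move=> z zx; exists x.
    have [d d0 Hd] := Phi_open (OO _ Ox) e0.
    have := (continuous_enormP G (s, sigma)).1 (G_cont (s, sigma) sg01) d d0.
    apply: filterS => -[t sg]/=; rewrite -xG => /Hd[z zx Phiz].
    by exists z => //; exact: He.
  have /nbhs_ballP[d /= d0 Hd] := near_N.
  exists d => // sg /andP[ssg sgd] sgle1 s s01.
  have sg01' : 0 <= sg <= 1 by rewrite sgle1 (le_trans sg0)// ltW.
  have {}Hd : forall s, 0 <= s <= 1 -> exists2 x, N x & Phi x = G (s, sg).
    move=> t t01; apply: Hd; last by rewrite /= in_itv.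
    by rewrite /ball/= ltr0_norm ?subr_lt0// opprB ltrBlDl.
  have [z Nz Phiz] := Hd s s01; exists z => //.
  apply: shrink_ball => c Cc.
  apply: (@chord_preimage_in_ball (shrink c) (l * r) x0 (xs sg)) Phiz => //.
  + by rewrite mulr_ge0// ltW.
  + exact: OO.
  + by apply: OO; exact: Oxs.
  + exact: shrink_dist.
  + by apply: shrink_dist => //; exact: Oxs.
  + move=> t /Hd[y Ny Phiy]; exists y; split=> //; first exact: N_nbhs.
    exact: N_dist.
  + exact: N_Omega.
- move=> sigma /andP[sg0 sg1] Pl s s01.
  have [x Ox <-] : (Phi @` Omega') (G (s, sigma)); last by exists x.
  apply: Phi_image_closed => // B GB.
  have Gs_cont : {for sigma, continuous (fun sg : R => G (s, sg))}.
    apply: (@continuous_comp _ _ _ (fun sg : R => (s, sg)) G).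
      exact: (cvg_pair (cvg_cst s) (@cvg_id _ (nbhs sigma))).
    by apply: G_cont; rewrite /= sg1 ltW.
  have /nbhs_ballP[d /= d0 Hd] := Gs_cont _ GB.
  pose u := Num.max 0 (sigma - d / 2).
  have us : u < sigma by rewrite gt_max sg0/= ltrBlDr ltrDl divr_gt0.
  have u0 : 0 <= u by rewrite le_max lexx.
  have [|x Ox xG] := Pl u _ s s01; first by rewrite u0.
  exists (G (s, u)); split; first by exists x.
  apply: (Hd u); rewrite /ball/= gtr0_norm ?subr_gt0//.
  have : sigma - d / 2 <= u by rewrite le_max lexx orbT.
  lra.
Qed.

End Shrinking.

(** The midpoint of two distinct points of [Omega] is interior, since balls are
    uniformly convex. Shrinking [Omega] towards it by a factor tending to 1
    gives the result, as the image of [Omega] is closed. *)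
Lemma image_convex x0 x1 s : Omega x0 -> Omega x1 -> 0 <= s <= 1 ->
  exists2 x, Omega x & Phi x = Phi x0 + s *: (Phi x1 - Phi x0).
Proof.
move=> Ox0 Ox1 s01; have [->|x01] := eqVneq x0 x1.
  by exists x1 => //; rewrite subrr scaler0 addr0.
pose c0 := 2^-1 *: (x0 + x1).
pose D := dot (x1 - x0) (x1 - x0).
have D0 : 0 < D by apply: dot_gt0; rewrite subr_eq0 eq_sym.
(* The midpoint is at squared distance at most r^2 - D / 4 from each centre, so
   that delta^2 + 2 * delta * r <= D / 4 is enough; and delta^2 <= delta. *)
pose delta := Num.min 1 (D / (8 * r + 4)).
have r4 : 0 < 8 * r + 4 by rewrite ltr_wpDl// mulr_ge0// ltW.
have delta0 : 0 < delta by rewrite lt_min ltr01 divr_gt0.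
have ball_Omega x : enorm (x - c0) < delta -> Omega x.
  move=> xc0 c Cc; have xc0d := ltW xc0.
  have c0c : dot (c0 - c) (c0 - c) <= r ^+ 2 - D / 4.
    have := Ox0 c Cc; have := Ox1 c Cc; rewrite /eball/= !(enorm_le_sqr _ (ltW r_gt0)).
    have -> : c0 - c = 2^-1 *: ((x0 - c) + (x1 - c)).
      by apply/rowP => i; rewrite /c0 !mxE; field.
    rewrite /D; have -> : x1 - x0 = (x1 - c) - (x0 - c).
      by apply/rowP => i; rewrite !mxE; ring.
    rewrite dotZl dotZr (dot_sqrD (x0 - c)) (dot_sqrB (x1 - c) (x0 - c)).
    by rewrite (dotC (x1 - c) (x0 - c)); lra.
  rewrite /eball/= (enorm_le_sqr _ (ltW r_gt0)).
  have -> : x - c = (x - c0) + (c0 - c) by rewrite addrA subrK.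
  rewrite (dot_sqrD (x - c0)).
  have c0r : enorm (c0 - c) <= r.
    by rewrite (enorm_le_sqr _ (ltW r_gt0)); have := D0; lra.
  have := cauchy_schwarz (x - c0) (c0 - c).
  have : enorm (x - c0) * enorm (c0 - c) <= delta * r.
    by apply: ler_pM; rewrite ?enorm_ge0.
  have : dot (x - c0) (x - c0) <= delta.
    rewrite -enorm_sqr expr2; apply: le_trans (_ : delta * 1 <= _); last by rewrite mulr1.
    apply: ler_pM; rewrite ?enorm_ge0//; apply: le_trans xc0d _.
    by rewrite ge_min lexx.
  have : delta * (8 * r + 4) <= D.
    by rewrite -ler_pdivlMr// ge_min lexx orbT.
  move: delta0 r_gt0; nra.
pose sh l x := c0 + l *: (x - c0).
pose G l := Phi (sh l x0) + s *: (Phi (sh l x1) - Phi (sh l x0)).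
have sh1 x : sh 1 x = x by rewrite /sh scale1r addrC subrK.
have [x Ox xG] : (Phi @` Omega) (G 1); last first.
  by exists x => //; rewrite xG /G !sh1.
apply: Phi_image_closed => // B GB.
have sh_cont x : {for 1, continuous (sh^~ x)} by exact: continuous_line.
have Phi_sh_cont x : Omega x -> {for 1, continuous (fun l => Phi (sh l x))}.
  move=> Ox; apply: (continuous_comp (@sh_cont x)).
  by rewrite sh1; exact: Phi_cont.
have G_cont : {for 1, continuous G}.
  apply: cvgD; first exact: Phi_sh_cont.
  apply: cvgZ; first exact: cvg_cst.
  by apply: cvgB; exact: Phi_sh_cont.
have /nbhs_ballP[d /= d0 Hd] := G_cont _ GB.
pose l := Num.max (2^-1) (1 - d / 2).
have l1 : l < 1 by rewrite gt_max invf_lt1 ?ltr1n//= ltrBlDr ltrDl divr_gt0.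
have l0 : 0 < l by rewrite lt_max invr_gt0 ltr0n.
have l01 : 0 < l < 1 by rewrite l0.
have shO y : Omega y -> ((fun x => c0 + l *: (x - c0)) @` Omega) (sh l y).
  by move=> Oy; exists y.
have [x [y Oy yx] xG] := shrunk_image_convex delta0 l01 ball_Omega
  (shO x0 Ox0) (shO x1 Ox1) s01.
exists (G l); split.
  exists x => //; rewrite -yx => c Cc; rewrite /eball/=.
  have -> : c0 + l *: (y - c0) - c = l *: (y - c) + (1 - l) *: (c0 - c).
    by apply/rowP => i; rewrite !mxE; ring.
  apply: le_trans (enormD _ _) _; rewrite !enormZ !gtr0_norm ?subr_gt0//.
  rewrite [leRHS](_ : r = l * r + (1 - l) * r); last by ring.
  apply: lerD; rewrite ler_pM2l ?subr_gt0//; first exact: Oy.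
  have : Omega c0 by apply: ball_Omega; rewrite subrr enorm0.
  exact.
apply: (Hd l); rewrite /ball/= gtr0_norm ?subr_gt0//.
have : 1 - d / 2 <= l by rewrite le_max lexx orbT.
lra.
Qed.

End ConvexImage.

(** * Quadratic forms, operator norm and upper limits *)

Section MatrixBounds.
Context {R : realType} {n : nat}.
Implicit Types (A : 'M[R]_n) (x y h : 'rV[R]_n).

Lemma dot_mulmx x y A : dot (x *m A) y = dot x (y *m A^T).
Proof.
have dotM u v : dot u v = (u *m v^T) 0 0.
  by rewrite mxE; apply: eq_bigr => i _; rewrite mxE.
by rewrite !dotM trmx_mul trmxK mulmxA.
Qed.

(** The constant is not sharp: only its uniformity in [A] and [h] matters. *)
Lemma enorm_mulmx_le h A : enorm (h *m A) <= n%:R * (n%:R * `|A|) * enorm h.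
Proof.
rewrite -!mulrA; apply: le_trans (enorm_le_norm _) _; rewrite ler_wpM2l//.
rewrite [leLHS]/Num.Def.normr/= mx_normrE; apply: bigmax_le => [|[i j] _].
  by rewrite !mulr_ge0// enorm_ge0.
rewrite /= mxE; apply: le_trans (ler_norm_sum _ _ _) _.
apply: (@le_trans _ _ (\sum_(k < n) `|A| * enorm h)).
  apply: ler_sum => k _; rewrite normrM mulrC; apply: ler_pM => //.
    exact: coord_le_norm.
  exact: le_trans (coord_le_norm _ _ _) (norm_le_enorm _).
by rewrite sumr_const card_ord -[leLHS]mulr_natl.
Qed.

Lemma continuous_mulmx A : continuous (fun h => h *m A).
Proof.
move=> x; apply/continuous_enormP => e e0; apply/nbhs_enormP.
set c := n%:R * (n%:R * `|A|).
have c0 : 0 < c + 1 by rewrite ltr_wpDl// !mulr_ge0.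
exists (e / (c + 1)); first by rewrite divr_gt0.
move=> y; rewrite ltr_pdivlMr// => yx; rewrite -mulmxBl.
apply: le_lt_trans (enorm_mulmx_le _ _) _; apply: le_lt_trans yx.
by rewrite mulrC ler_wpM2l ?enorm_ge0// lerDl.
Qed.

Lemma dot_sympart h A : dot h (h *m sympart A) = dot h (h *m A).
Proof.
rewrite /sympart -scalemxAr mulmxDr dotZr dotDr -dot_mulmx (dotC (_ *m _)).
by field.
Qed.

(** First-order condition at a minimum of a quadratic polynomial. *)
Lemma linear_coef_eq0 (b c : R) :
  (forall e, 0 <= e * b + e ^+ 2 * c) -> b = 0.
Proof.
move=> H; apply/eqP/negPn/negP => b0.
have c0 : 0 < `|c| + 1 by rewrite ltr_wpDl.
have := H (- b / (`|c| + 1)).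
have b2 : 0 < b ^+ 2 by rewrite exprn_even_gt0.
have -> : - b / (`|c| + 1) * b + (- b / (`|c| + 1)) ^+ 2 * c =
    - (b ^+ 2) / (`|c| + 1) ^+ 2 * ((`|c| + 1) - c).
  by field; rewrite gt_eqF.
rewrite mulNr mulNr oppr_ge0 leNgt => /negP; apply.
apply: mulr_gt0; first by rewrite divr_gt0// exprn_gt0.
by have := ler_norm c; lra.
Qed.

(** The Rayleigh quotient attains its maximum on the unit sphere, and a
    maximiser is an eigenvector. *)
Lemma dot_mulmx_le_mu_max h A : dot h (h *m A) <= mu_max A * dot h h.
Proof.
have [->|h0] := eqVneq h 0; first by rewrite !dot0l mulr0.
rewrite -dot_sympart /mu_max; set S := sympart A.
have St : S^T = S by rewrite /S /sympart linearZ/= linearD/= trmxK addrC.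
pose f x := dot x (x *m S).
have f_cont : continuous f.
  move=> x; have cS := @continuous_mulmx S x.
  have ci : {for x, continuous (fun y : 'rV[R]_n => y)} by move=> B.
  exact: (continuous_dot ci cS).
pose K := [set x : 'rV[R]_n | enorm x = 1].
have K_compact : compact K.
  apply: (subclosed_compact _ (@compact_eball R n 0 1)); last first.
    by move=> x /= Kx; rewrite /eball/= subr0 Kx.
  rewrite (_ : K = @enorm R n @^-1` [set 1])//.
  by apply: closed_comp (@closed_eq _ 1) => x _; exact: enorm_continuous.
have hh0 : 0 < enorm h by exact: enorm_gt0.
have Kscale x : x != 0 -> K ((enorm x)^-1 *: x).
  move=> /enorm_gt0 x0; rewrite /K/= enormZ gtr0_norm ?invr_gt0//.
  by rewrite mulVf// gt_eqF.
have [||z] := @EVT_max_rV R n f K _ K_compact.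
- by exists ((enorm h)^-1 *: h); exact: Kscale.
- exact: continuous_subspaceT.
rewrite inE => Kz zmax; set a := f z in zmax.
have fle x : f x <= a * dot x x.
  have [->|x0] := eqVneq x 0; first by rewrite /f !dot0l mulr0.
  have := zmax ((enorm x)^-1 *: x); rewrite inE => /(_ (Kscale x x0)).
  rewrite /f -scalemxAl dotZl dotZr mulrA -expr2 exprVn mulrC.
  by rewrite ler_pdivrMr ?exprn_gt0 ?enorm_gt0// enorm_sqr.
have zz : dot z z = 1 by rewrite -enorm_sqr Kz expr1n.
have zE : z *m S = a *: z.
  apply/eqP; rewrite -subr_eq0; apply/eqP; apply: dot_eq0.
  set y := z *m S - a *: z.
  suff : 2 * (a * dot z y - dot y (z *m S)) = 0.
    have yy : dot y y = dot y (z *m S) - a * dot z y.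
      have key u w : dot u (w - a *: z) = dot u w - a * dot z u.
        by rewrite dotDr dotNr dotZr (dotC z).
      exact: key.
    by rewrite yy; lra.
  apply: (@linear_coef_eq0 _ (a * dot y y - f y)) => e.
  have := fle (z + e *: y); rewrite {1}/f mulmxDl -scalemxAl.
  rewrite -subr_ge0 (_ : _ - _ = e * (2 * (a * dot z y - dot y (z *m S))) +
    e ^+ 2 * (a * dot y y - f y))//.
  have zy : dot z (y *m S) = dot y (z *m S) by rewrite dotC dot_mulmx St.
  have := zz; rewrite /a /f; clearbody y => zz'.
  rewrite !dotE zy (dotC y z); ring: zz'.
have z0 : z != 0.
  by apply: contra_eq_neq Kz => ->; rewrite enorm0 eq_sym oner_eq0.
apply: le_trans (fle h) _; rewrite ler_wpM2r ?dot_ge0//.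
apply: ub_le_sup; last by apply/eigenvalueP; exists z.
exists a => b /eigenvalueP[v vE v0].
have := fle v; rewrite /f vE dotZr.
by rewrite ler_pM2r// dot_gt0.
Qed.

Lemma mu_min_opp A : mu_min A = - mu_max (- A).
Proof.
have H B a : eigenvalue (sympart B) a -> eigenvalue (sympart (- B)) (- a).
  move=> /eigenvalueP[v vE v0]; apply/eigenvalueP; exists v => //.
  by rewrite /sympart linearN/= -opprD scalerN mulmxN vE scaleNr.
rewrite /mu_min /inf /mu_max; congr (- sup _); apply/seteqP; split => a /=.
  by move=> [b bE <-]; exact: H.
by move=> /H; rewrite opprK => aE; exists (- a) => //; rewrite opprK.
Qed.

Lemma mu_min_le_dot_mulmx h A : mu_min A * dot h h <= dot h (h *m A).
Proof.
rewrite mu_min_opp mulNr lerNl; apply: le_trans (dot_mulmx_le_mu_max _ _).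
by rewrite mulmxN dotNr.
Qed.

Lemma enorm_mulmx_le_opnorm h A : enorm (h *m A) <= opnorm A * enorm h.
Proof.
have [->|/enorm_gt0 h0] := eqVneq h 0; first by rewrite mul0mx enorm0 mulr0.
rewrite -ler_pdivrMr// mulrC -[(enorm h)^-1]gtr0_norm ?invr_gt0// -enormZ scalemxAl.
apply: ub_le_sup; last first.
  exists ((enorm h)^-1 *: h) => //=; rewrite enormZ gtr0_norm ?invr_gt0//.
  by rewrite mulVf ?gt_eqF.
exists (n%:R * (n%:R * `|A|)) => _ [x /= x1 <-].
apply: le_trans (enorm_mulmx_le _ _) _.
by rewrite ler_piMr// !mulr_ge0.
Qed.

Lemma limf_esup_le_near (f : 'rV[R]_n -> \bar R) (F : set_system 'rV[R]_n)
    (M e : R) : (limf_esup f F <= M%:E)%E -> 0 < e ->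
  exists2 W, F W & forall x, W x -> (f x <= (M + e)%:E)%E.
Proof.
move=> fM e0.
have : (limf_esup f F < (M + e)%:E)%E.
  by apply: le_lt_trans fM _; rewrite lte_fin ltrDl.
rewrite /limf_esup => /ereal_inf_lt[_ [W FW <-] /ltW supW].
exists W => // x Wx; apply: le_trans supW.
by apply: ereal_sup_ubound; exists x.
Qed.

End MatrixBounds.

(** * Gronwall estimates *)

Section Gronwall.
Context {R : realType}.
Implicit Types (f g df : R -> R) (a b c s : R).

Lemma is_derive_exp_affine c a s :
  is_derive s (1 : R) (fun u => expR (c * (u - a))) (c * expR (c * (s - a))).
Proof.
have lin : is_derive s (1 : R) (fun u : R => c * (u - a)) c.
  have -> : (fun u : R => c * (u - a)) = c \*: (id - cst a) by [].
  by apply: is_derive_eq; rewrite subr0 /GRing.scale/= mulr1.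
by rewrite mulrC; exact: (is_derive1_comp (is_derive_expR _) lin).
Qed.

(** Multiply by the integrating factor [expR (- c * (s - a))]. *)
Lemma gronwall_le (E : set R) f df a b c : finite_set E -> a <= b ->
    (forall s, a <= s <= b -> {for s, continuous f}) ->
    (forall s, a < s < b -> ~ E s -> is_derive s (1 : R) f (df s)) ->
    (forall s, a < s < b -> ~ E s -> df s <= c * f s) ->
  f b <= expR (c * (b - a)) * f a.
Proof.
move=> Efin ab cf fD dfle.
pose g s := expR (- c * (s - a)) * f s.
have : - g a <= - g b.
  apply: (@le_of_derive_ge0_except R E (fun s => - g s)
    (fun s => expR (- c * (s - a)) * (c * f s - df s)) a b Efin ab _ _ _) => s sab.
  - apply: continuousN; apply: continuousM; last exact: cf.
    exact: is_derive_continuous (is_derive_exp_affine _ _ _).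
  - move=> nE; have fDs := fD s sab nE; have eD := is_derive_exp_affine (- c) a s.
    apply: is_derive_eq (is_deriveN (is_deriveM eD fDs)) _.
    by rewrite /GRing.scale/=; ring.
  - by move=> nE; rewrite mulr_ge0 ?expR_ge0// subr_ge0 dfle.
rewrite lerN2 /g subrr mulr0 expR0 mul1r => gle.
have -> : f b = expR (c * (b - a)) * (expR (- c * (b - a)) * f b).
  by rewrite mulrA -expRD mulNr subrr expR0 mul1r.
by rewrite ler_wpM2l// expR_ge0.
Qed.

Lemma gronwall_ge (E : set R) f df a b c : finite_set E -> a <= b ->
    (forall s, a <= s <= b -> {for s, continuous f}) ->
    (forall s, a < s < b -> ~ E s -> is_derive s (1 : R) f (df s)) ->
    (forall s, a < s < b -> ~ E s -> - (c * f s) <= df s) ->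
  f a <= expR (c * (b - a)) * f b.
Proof.
move=> Efin ab cf fD dfge.
have : - f b <= expR (- c * (b - a)) * - f a.
  apply: (@gronwall_le E (fun s => - f s) (fun s => - df s) a b (- c) Efin ab
    _ _ _) => s sab.
  - by apply: continuousN; exact: cf.
  - by move=> nE; have fDs := fD s sab nE; exact: is_deriveN.
  - by move=> nE; have := dfge s sab nE; lra.
rewrite mulrN lerN2 => fle.
have -> : f a = expR (c * (b - a)) * (expR (- c * (b - a)) * f a).
  by rewrite mulrA -expRD mulNr subrr expR0 mul1r.
by rewrite ler_wpM2l// expR_ge0.
Qed.

End Gronwall.

(** * One-sided limits of admissible inputs *)

Section AdmissibleInputs.
Context {R : realType} {m : nat} (T : R) (V : set 'rV[R]_m)
  (U : set (R -> 'rV[R]_m)).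
Context (T_gt0 : 0 < T) (U_pc : forall u, U u -> piecewise_continuous T V u).
Context (v : R -> 'rV[R]_m) (v_adm : admissible T U v).

Let period s : 0 <= s -> exists k : nat, k%:R * T <= s < k.+1%:R * T.
Proof.
move=> s0; exists (Num.truncn (s / T)).
have sT : 0 <= s / T by rewrite divr_ge0// ltW.
by rewrite -ler_pdivlMr// -ltr_pdivrMr// truncn_itv.
Qed.

Lemma admissible_val s : 0 <= s -> V (v s).
Proof.
move=> /period[k /andP[ks sk]]; have [u [Uu vE]] := v_adm.
rewrite (vE k s) ?ks//; have [uV _ _ _] := U_pc (Uu k); apply: uV.
by move: sk; rewrite subr_ge0 ks -natr1 mulrDl mul1r; lra.
Qed.

Let shift_right (u : R -> 'rV[R]_m) (l : 'rV[R]_m) (k s : R) : u x @[x --> (s - k)^'+] --> l ->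
  u (x - k) @[x --> s^'+] --> l.
Proof.
move=> ul B /ul/= /nbhs_ballP[d /= d0 Hd]; apply/nbhs_ballP; exists d => //= y ys sy.
apply: Hd; last by rewrite ltrD2r.
by move: ys; rewrite /ball/= opprB addrA subrK.
Qed.

Let shift_left (u : R -> 'rV[R]_m) (l : 'rV[R]_m) (k s : R) : u x @[x --> (s - k)^'-] --> l ->
  u (x - k) @[x --> s^'-] --> l.
Proof.
move=> ul B /ul/= /nbhs_ballP[d /= d0 Hd]; apply/nbhs_ballP; exists d => //= y ys sy.
apply: Hd; last by rewrite ltrD2r.
by move: ys; rewrite /ball/= opprB addrA subrK.
Qed.

Let period_shift k s : k%:R * T <= s < k.+1%:R * T -> 0 <= s - k%:R * T < T.
Proof.
by move=> /andP[h1]; rewrite subr_ge0 h1 -natr1 mulrDl mul1r; lra.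
Qed.

Lemma admissible_right s : 0 <= s -> exists2 l, V l & v x @[x --> s^'+] --> l.
Proof.
move=> /period[k ks]; have [u [Uu vE]] := v_adm.
have [_ _ /(_ _ (period_shift ks))[l Vl ul] _] := U_pc (Uu k).
exists l => //; apply: cvg_trans (shift_right ul); apply: near_eq_cvg.
case/andP: ks => ks sk; have sk' : 0 < k.+1%:R * T - s by rewrite subr_gt0.
apply/nbhs_ballP; exists (k.+1%:R * T - s) => //= y ys sy.
rewrite (vE k)//; move: ys; rewrite /ball/= ltr0_norm ?subr_lt0//.
by move=> ?; apply/andP; split; lra.
Qed.

Lemma admissible_left s : 0 < s -> exists2 l, V l & v x @[x --> s^'-] --> l.
Proof.
move=> s0; have [u [Uu vE]] := v_adm.
have [k ks] : exists k : nat, k%:R * T < s <= k.+1%:R * T.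
  have [k /andP[ks sk]] := period (ltW s0).
  move: ks; rewrite le_eqVlt => /predU1P[ks|ks]; last by exists k; rewrite ks ltW.
  case: k ks sk => [|k] ks sk; first by move: s0; rewrite -ks mul0r ltxx.
  by exists k; rewrite -ks lexx andbT ltr_pM2r// ltr_nat.
have ks' : 0 < s - k%:R * T <= T.
  by case/andP: ks => h1; rewrite subr_gt0 h1 -natr1 mulrDl mul1r; lra.
have [_ _ _ /(_ _ ks')[l Vl ul]] := U_pc (Uu k).
exists l => //; apply: cvg_trans (shift_left ul); apply: near_eq_cvg.
case/andP: ks => ks sk; have sk' : 0 < s - k%:R * T by rewrite subr_gt0.
apply/nbhs_ballP; exists (s - k%:R * T) => //= y ys sy.
rewrite (vE k)//; move: ys; rewrite /ball/= gtr0_norm ?subr_gt0//.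
by move=> ?; apply/andP; split; lra.
Qed.

Lemma admissible_discontinuities t :
  finite_set [set s | 0 < s < t /\ ~ {for s, continuous v}].
Proof.
have [u [Uu vE]] := v_adm.
pose J k := [set s | 0 < s < T /\ ~ {for s, continuous (u k)}].
pose N := (Num.truncn (t / T)).+1.
pose D := \bigcup_(k in `I_N) ([set k%:R * T] `|` (fun s => s + k%:R * T) @` J k).
apply: (@sub_finite_set _ _ D); last first.
  apply: bigcup_finite; first exact: finite_II.
  move=> k _; rewrite finite_setU; split; first exact: finite_set1.
  by apply: finite_image; have [_ + _ _] := U_pc (Uu k).
move=> s /= [/andP[s0 st] ncv]; have [k ks] := period (ltW s0).
exists k => /=.
  have t0 : 0 <= t / T by rewrite divr_ge0 ?ltW// (lt_trans s0).
  rewrite -(ltr_nat R); have /andP[_] := truncn_itv t0; apply: le_lt_trans.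
  by rewrite ler_pdivlMr//; case/andP: ks => ks _; rewrite (le_trans ks)// ltW.
move: (ks) => /andP[]; rewrite le_eqVlt => /predU1P[-> _|ks0 ks1]; first by left.
right; exists (s - k%:R * T); last by rewrite subrK.
have /andP[h1 h2] := period_shift ks.
split; first by rewrite h2 subr_gt0 ks0.
apply: contra_not ncv => cu.
have e0 : 0 < Num.min (s - k%:R * T) (k.+1%:R * T - s).
  by rewrite lt_min !subr_gt0 ks0.
have vs : v s = u k (s - k%:R * T) by apply: vE.
move=> B; rewrite vs => /cu/nbhs_ballP[d /= d0 Hd].
apply/nbhs_ballP; exists (Num.min d (Num.min (s - k%:R * T) (k.+1%:R * T - s))) => /=.
  by rewrite lt_min d0.
move=> y; rewrite /ball/= !lt_min => /and3P[yd y1 y2].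
rewrite /= (vE k); first by apply: Hd; rewrite /ball/= opprB addrA subrK.
move: y1 y2; rewrite !ltr_norml => /andP[a1 a2] /andP[b1 b2].
by apply/andP; split; lra.
Qed.

(** A property which holds near every limit value [l] of the input holds along
    the input near [s0]: it suffices to apply it to the left limit, the right
    limit and the value at [s0]. The parameter [e] carries constants that
    depend on the limit value. *)
Lemma near_admissible s0 (Q : R -> R -> 'rV[R]_m -> Prop) : 0 <= s0 ->
    (forall e e' s w, e' <= e -> Q e s w -> Q e' s w) ->
    (forall l, V l -> exists2 e, 0 < e & forall s w,
      `|s - s0| < e -> enorm (w - l) < e -> V w -> Q e s w) ->
  exists2 e, 0 < e & \forall s \near s0, 0 <= s -> Q e s (v s).
Proof.
move=> s00 Qmono HQ.
have near_lim l (F : set_system R) : V l -> Filter F -> F --> s0 ->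
    v x @[x --> F] --> l ->
    exists2 e, 0 < e & (\forall s \near F, 0 <= s -> Q e s (v s)).
  move=> Vl FF Fs0 vl; have [e e0 He] := HQ l Vl; exists e => //.
  have h1 : \forall s \near F, `|s - s0| < e.
    by apply: Fs0; apply/nbhs_ballP; exists e => //= y; rewrite /ball/= distrC.
  have h2 : \forall s \near F, enorm (v s - l) < e.
    by apply: (vl (fun w => enorm (w - l) < e)); apply/nbhs_enormP; exists e.
  by near=> s => s_ge0; apply: He; [near: s|near: s|exact: admissible_val].
have [e1 e10] : exists2 e, 0 < e & \forall s \near s0^'+, 0 <= s -> Q e s (v s).
  have [l Vl vl] := admissible_right s00.
  by apply: near_lim vl => //; exact: cvg_within.
have [e2 e20] : exists2 e, 0 < e & \forall s \near s0^'-, 0 <= s -> Q e s (v s).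
  move: s00; rewrite le_eqVlt => /predU1P[s00|s00].
    exists 1 => //.
    by apply/nbhs_ballP; exists 1 => //= y _ ys; rewrite leNgt s00 ys.
  have [l Vl vl] := admissible_left s00.
  by apply: near_lim vl => //; exact: cvg_within.
have [e3 e30 at_s] : exists2 e, 0 < e & Q e s0 (v s0).
  have Vs := admissible_val s00; have [e e0 He] := HQ _ Vs; exists e => //.
  by apply: He => //; rewrite subrr ?normr0 ?enorm0.
move=> /nbhs_ballP[d2 /= d20 H2] /nbhs_ballP[d1 /= d10 H1].
exists (Num.min e1 (Num.min e2 e3)); first by rewrite !lt_min e10 e20.
apply/nbhs_ballP; exists (Num.min d1 d2); first by rewrite /= lt_min d10.
move=> y; rewrite /ball/= lt_min => /andP[y1 y2] y0.
have [ys|ys|->] := ltgtP y s0.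
- by apply: (Qmono e2); [rewrite !ge_min lexx !orbT | exact: H2].
- by apply: (Qmono e1); [rewrite !ge_min lexx | exact: H1].
- by apply: (Qmono e3) => //; rewrite !ge_min lexx !orbT.
Unshelve. all: by end_near. Qed.

End AdmissibleInputs.

(** * Lipschitz continuity of the vector field *)

Section VectorField.
Context {R : realType} {n m : nat} (X : set 'rV[R]_n) (V : set 'rV[R]_m)
  (F : 'rV[R]_n -> 'rV[R]_m -> 'rV[R]_n).
Context (X_open : open X) (F_C1 : C1_fst X V F).
Implicit Types (a b h x y : 'rV[R]_n) (w l : 'rV[R]_m).

Lemma is_derive_line b h w (theta : R) : X (b + theta *: h) -> V w ->
  is_derive theta (1 : R) (fun s : R => F (b + s *: h) w)
    (h *m D1 F (b + theta *: h) w).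
Proof.
move=> Xb Vw; have dF := F_C1.1 _ _ Xb Vw.
have E : (fun k : R => k^-1 *: (F (b + (k *: (1 : R) + theta) *: h) w -
      F (b + theta *: h) w)) =
    (fun k : R => k^-1 *: (F (k *: h + (b + theta *: h)) w -
      F (b + theta *: h) w)).
  apply/funext => k; do 3 f_equal; rewrite [_ *: 1]mulr1 scalerDl.
  by rewrite addrCA.
have dv : derivable (F^~ w) (b + theta *: h) h by exact: diff_derivable.
split; first by move: dv; rewrite /derivable /= E.
by have := deriveEjacobian h dF; rewrite /derive /= E.
Qed.

Lemma ball_convex y a b (e theta : R) : 0 <= theta <= 1 ->
  enorm (a - y) < e -> enorm (b - y) < e -> enorm (b + theta *: (a - b) - y) < e.
Proof.
move=> /andP[t0 t1] ay by_.
rewrite (_ : _ - y = theta *: (a - y) + (1 - theta) *: (b - y)); last first.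
  by apply/rowP => i; rewrite !mxE; ring.
apply: le_lt_trans (enormD _ _) _; rewrite !enormZ !ger0_norm ?subr_ge0//.
rewrite (_ : e = theta * e + (1 - theta) * e); last by ring.
have [t00|tn0] := eqVneq theta 0; first by rewrite t00 !mul0r subr0 !mul1r !add0r.
apply: ltr_leD; first by rewrite ltr_pM2l// lt0r tn0.
by rewrite ler_wpM2l ?subr_ge0// ltW.
Qed.

(** The constant is uniform in [w] near [l], as inputs need not be continuous. *)
Lemma F_locally_lipschitz y l : X y -> V l ->
  exists2 e : R, 0 < e & exists2 L : R, 0 <= L & forall a b w,
    enorm (a - y) < e -> enorm (b - y) < e -> enorm (w - l) < e -> V w ->
    X a /\ enorm (F a w - F b w) <= L * enorm (a - b).
Proof.
move=> Xy Vl.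
have [e1 e10 He1] := (nbhs_enormP _ _).1 (open_nbhs_nbhs (conj X_open Xy)).
have /subspace_continuousP/(_ (y, l) (conj Xy Vl)) := F_C1.2.
move=> /cvgrPdist_lt/(_ _ ltr01)/nbhs_ballP[e2 /= e20 He2].
pose e := Num.min e1 e2.
have e0 : 0 < e by rewrite lt_min e10.
have Xe x : enorm (x - y) < e -> X x.
  by rewrite lt_min => /andP[xy _]; exact: He1.
pose B := `|D1 F y l| + 1.
have D1B x w : enorm (x - y) < e -> enorm (w - l) < e -> V w -> `|D1 F x w| <= B.
  move=> xy wl Vw; have := He2 (x, w); rewrite /ball/= /prod_ball/=.
  rewrite -!ball_normE/= => /(_ _ _)/ltW H.
  rewrite /B -lerBlDl; apply: le_trans (lerB_dist _ _) _; rewrite distrC; apply: H.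
    by split; apply: le_lt_trans (norm_le_enorm _) _; rewrite enormC;
      [move: xy | move: wl]; rewrite lt_min => /andP[].
  by split => //; exact: Xe.
have B0 : 0 <= B by rewrite addr_ge0.
pose L := n%:R * (n%:R * B).
have L0 : 0 <= L by rewrite !mulr_ge0.
exists e => //; exists L => // a b w ay by_ wl Vw; split; first exact: Xe.
pose h := a - b.
have inball (s : R) : 0 <= s <= 1 -> enorm (b + s *: h - y) < e.
  by move=> s01; exact: ball_convex.
apply: enorm_dual => [|u]; first by rewrite mulr_ge0 ?enorm_ge0.
pose c := enorm u * (L * enorm h).
pose f (s : R) := c * s - dot u (F (b + s *: h) w).
have fD (s : R) : 0 <= s <= 1 ->
    is_derive s (1 : R) f (c - dot u (h *m D1 F (b + s *: h) w)).
  move=> s01; have FD := is_derive_line (Xe _ (inball s s01)) Vw.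
  have uD := is_derive_dot (is_derive_cst u s 1) FD.
  have cD : is_derive s (1 : R) (fun s : R => c * s) c.
    have -> : (fun s : R => c * s) = c \*: id by [].
    by apply: is_derive_eq; rewrite /GRing.scale/= mulr1.
  by apply: is_derive_eq (is_deriveB cD uD) _; rewrite dot0l addr0.
have : f 0 <= f 1.
  apply: (@le_of_derive_ge0_except R set0 f
    (fun s : R => c - dot u (h *m D1 F (b + s *: h) w)) 0 1
    (finite_set0 _) ler01 _ _ _).
  - by move=> s s01; exact: is_derive_continuous (fD s s01).
  - by move=> s /andP[s0 s1] _; apply: fD; rewrite !ltW.
  - move=> s /andP[s0 s1] _; rewrite subr_ge0; apply: le_trans (cauchy_schwarz _ _) _.
    rewrite ler_wpM2l ?enorm_ge0//; apply: le_trans (enorm_mulmx_le _ _) _.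
    rewrite ler_wpM2r ?enorm_ge0// /L !ler_wpM2l//.
    by apply: D1B => //; apply: inball; rewrite !ltW.
rewrite /f mulr0 mulr1 scale0r addr0 scale1r [b + h]addrC subrK dotDr dotNr.
by rewrite /c; lra.
Qed.

End VectorField.

(** * Lipschitz bounds and injectivity of the flow *)

Section Flow.
Context {R : realType} {n m : nat} (X : set 'rV[R]_n) (V : set 'rV[R]_m)
  (F : 'rV[R]_n -> 'rV[R]_m -> 'rV[R]_n) (T : R) (U : set (R -> 'rV[R]_m)).
Context (X_open : open X) (F_C1 : C1_fst X V F) (T_gt0 : 0 < T)
  (U_pc : forall u, U u -> piecewise_continuous T V u).
Context (v : R -> 'rV[R]_m) (v_adm : admissible T U v).
Context (xi : 'rV[R]_n -> R -> 'rV[R]_n).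
Implicit Types (x y z : 'rV[R]_n) (a b c d e s t : R).
Context (xi0 : forall x, X x -> xi x 0 = x)
  (xi_X : forall x s, X x -> X (xi x s))
  (xi_cont : forall x, X x -> continuous (xi x))
  (xi_deriv : forall x s, X x -> 0 < s -> {for s, continuous v} ->
    is_derive s (1 : R) (xi x) (F (xi x s) (v s))).
Context (t : R).

Definition jumps := [set s | 0 < s < t /\ ~ {for s, continuous v}].

Let jumps_finite : finite_set jumps.
Proof. exact: (admissible_discontinuities T_gt0 U_pc v_adm). Qed.

Let v_V s : 0 <= s -> V (v s).
Proof. exact: (admissible_val T_gt0 U_pc v_adm). Qed.

Let cont_at s a b : 0 <= a -> b <= t -> a < s < b -> ~ jumps s ->
  0 < s /\ {for s, continuous v}.
Proof.
move=> a0 bt /andP[as_ sb] nj; have s0 : 0 < s by exact: le_lt_trans as_.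
split=> //; apply: contrapT => ncv; apply: nj; split=> //.
by rewrite s0 (lt_le_trans sb).
Qed.

Lemma xi_sub_cont y z s : X y -> X z ->
  {for s, continuous (fun u => xi y u - xi z u)}.
Proof. by move=> Xy Xz; apply: continuousB; exact: xi_cont. Qed.

Lemma xi_sub_deriv y z s : X y -> X z -> 0 < s -> {for s, continuous v} ->
  is_derive s (1 : R) (fun u => xi y u - xi z u)
    (F (xi y s) (v s) - F (xi z s) (v s)).
Proof.
by move=> Xy Xz s0 cv; apply: (is_deriveB (xi_deriv Xy s0 cv) (xi_deriv Xz s0 cv)).
Qed.

Definition tube_lip x e L := forall s, 0 <= s <= t -> forall p q,
  enorm (p - xi x s) < e -> enorm (q - xi x s) < e ->
  X p /\ enorm (F p (v s) - F q (v s)) <= L * enorm (p - q).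

(** By compactness of the time interval. A single parameter [e] serves both as radius and,
    through [e^-1], as Lipschitz constant, so that it can be chosen uniformly. *)
Lemma tube_lip_exists x : X x ->
  exists2 e, 0 < e & exists2 L, 0 <= L & tube_lip x e L.
Proof.
move=> Xx.
pose Q e s w := forall p q, enorm (p - xi x s) < e -> enorm (q - xi x s) < e ->
  X p /\ enorm (F p w - F q w) <= e^-1 * enorm (p - q).
have near_Q s0 : `[0, t]%classic s0 -> \forall s \near s0 & e \near (0 : R)^'+,
    `[0, t]%classic s -> 0 < e /\ Q e s (v s).
  rewrite /= in_itv/= => /andP[s00 _].
  have [|l Vl|e e0 /nbhs_ballP[d /= d0 Hd]] :=
    near_admissible T_gt0 U_pc v_adm
      (Q := fun e s w => 0 < e -> Q e s w) s00.
  - move=> e e' s w ee' Qe e'0 p q px qx.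
    have e0 : 0 < e by exact: lt_le_trans ee'.
    have [||Xp Fpq] := Qe e0 p q; [exact: lt_le_trans ee'..|].
    split=> //; apply: le_trans Fpq _.
    by rewrite ler_wpM2r ?enorm_ge0// lef_pV2.
  - have [e1 e10 [L L0 HL]] := F_locally_lipschitz X_open F_C1 (xi_X s0 Xx) Vl.
    have e12 : 0 < e1 / 2 by rewrite divr_gt0.
    have /continuous_enormP/(_ _ e12)/nbhs_ballP[d /= d0 Hd] := @xi_cont x Xx s0.
    have L1 : 0 < L + 1 by rewrite ltr_wpDl.
    pose e := Num.min (Num.min d (e1 / 2)) (L + 1)^-1.
    exists e; first by rewrite !lt_min d0 e12 invr_gt0.
    move=> s w ss0 wl Vw e0 p q px qx.
    have xis : enorm (xi x s - xi x s0) < e1 / 2.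
      by apply: Hd; rewrite /ball/= distrC (lt_le_trans ss0)// !ge_min lexx.
    have tri u : enorm (u - xi x s) < e -> enorm (u - xi x s0) < e1.
      move=> ux; apply: le_lt_trans (enorm_triangle (xi x s) u _) _.
      rewrite [e1]splitr ltrD// (lt_le_trans ux)//.
      by rewrite !ge_min lexx orbT.
    have [||||Xp Fpq] := HL p q w.
    + exact: tri.
    + exact: tri.
    + apply: lt_le_trans wl _; rewrite !ge_min; apply/orP; left; apply/orP; right.
      by have := e10; lra.
    + by [].
    split=> //; apply: le_trans Fpq _; rewrite ler_wpM2r ?enorm_ge0//.
    apply: (@le_trans _ _ (L + 1)); first by rewrite lerDl.
    by rewrite -[leLHS]invrK lef_pV2 ?posrE ?invr_gt0// !ge_min lexx orbT.
  exists (ball s0 d, [set e' | 0 < e' < e]) => /=.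
    split; first by apply/nbhs_ballP; exists d.
    by apply/nbhs_ballP; exists e => //= e' + e'0; rewrite /ball/= sub0r normrN gtr0_norm// e'0.
  move=> [s e'] /= [ss0 /andP[e'0 e'e]]; rewrite in_itv/= => /andP[s0_ _].
  split=> // p q px qx; have [||Xp Fpq] := Hd s ss0 s0_ e0 p q.
  - exact: lt_trans e'e.
  - exact: lt_trans e'e.
  split=> //; apply: le_trans Fpq _.
  by rewrite ler_wpM2r ?enorm_ge0// lef_pV2 ?posrE// ltW.
have /compact_near_coveringP/near_covering_withinP cov := @segment_compact R 0 t.
have PF : ProperFilter (0 : R)^'+ by exact: at_right_proper_filter.
have [e He] := filter_ex
  (cov R (0 : R)^'+ (fun e s => 0 < e /\ Q e s (v s)) _ near_Q).
have [t0|t0] := leP 0 t; last first.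
  exists 1 => //; exists 0 => // s /andP[s0 st].
  by have := le_lt_trans (le_trans s0 st) t0; rewrite ltxx.
have [|e0 _] := He 0; first by rewrite /= in_itv/= lexx.
exists e => //; exists e^-1; first by rewrite invr_ge0 ltW.
by move=> s st; have [|_] := He s; first by rewrite /= in_itv.
Qed.

Section Growth.
Context (x : 'rV[R]_n) (e L : R) (L_ge0 : 0 <= L) (tubeL : tube_lip x e L).
Context (y z : 'rV[R]_n) (Xy : X y) (Xz : X z) (a b : R).
Context (a_ge0 : 0 <= a) (b_le : b <= t).
Context (close : forall s, a < s < b ->
  enorm (xi y s - xi x s) < e /\ enorm (xi z s - xi x s) < e).
Let D s := xi y s - xi z s.
Let dF s := F (xi y s) (v s) - F (xi z s) (v s).

Let dF_le s : a < s < b -> enorm (dF s) <= L * enorm (D s).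
Proof.
move=> asb; have [ys zs] := close asb; case/andP: asb => as_ sb.
have s0t : 0 <= s <= t by rewrite (le_trans a_ge0 (ltW as_)) (le_trans (ltW sb)).
by have [] := tubeL s0t ys zs.
Qed.

Let dDD s : a < s < b -> ~ jumps s ->
  is_derive s (1 : R) (fun u => dot (D u) (D u)) (2 * dot (D s) (dF s)).
Proof.
move=> asb nj; have [s0 cv] := cont_at a_ge0 b_le asb nj.
have DD := xi_sub_deriv Xy Xz s0 cv.
by apply: is_derive_eq (is_derive_dot DD DD) _; rewrite (dotC _ (D s)) -/(dF s) -mulr2n mulr_natl.
Qed.

Let DD_cont s : {for s, continuous (fun u => dot (D u) (D u))}.
Proof. by have cD := @xi_sub_cont y z s Xy Xz; exact: (continuous_dot cD cD). Qed.

Let DdF s : a < s < b -> `|2 * dot (D s) (dF s)| <= 2 * L * dot (D s) (D s).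
Proof.
move=> asb; rewrite normrM ger0_norm// -mulrA ler_pM2l//.
have H w : dot w (dF s) <= enorm w * (L * enorm (D s)).
  apply: le_trans (cauchy_schwarz _ _) _.
  by rewrite ler_wpM2l ?enorm_ge0// dF_le.
have -> : L * dot (D s) (D s) = enorm (D s) * (L * enorm (D s)).
  by rewrite -enorm_sqr expr2 mulrCA.
apply/ler_normlP; split; last exact: H.
by rewrite -(dotNl (D s)); apply: le_trans (H _) _; rewrite enormN.
Qed.

Let sqr_le p q (k : R) : 0 <= k -> dot p p <= expR (2 * k) * dot q q ->
  enorm (p : 'rV[R]_n) <= expR k * enorm (q : 'rV[R]_n).
Proof.
move=> k0 pq; rewrite enorm_le_sqr; last by rewrite mulr_ge0 ?expR_ge0 ?enorm_ge0.
by rewrite exprMn enorm_sqr -expRM_natl.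
Qed.

(** Gronwall for the squared distance, forwards and backwards in time. *)
Lemma dist_growth : a <= b ->
  enorm (D b) <= expR (L * (b - a)) * enorm (D a) /\
  enorm (D a) <= expR (L * (b - a)) * enorm (D b).
Proof.
move=> ab; have Lba : 0 <= L * (b - a) by rewrite mulr_ge0// subr_ge0.
split; apply: sqr_le => //; rewrite mulrA.
  apply: (@gronwall_le R jumps (fun u => dot (D u) (D u))
    (fun s => 2 * dot (D s) (dF s)) a b _ jumps_finite ab _ _ _) => s asb.
  - exact: DD_cont.
  - exact: dDD.
  - by move=> _; have := DdF asb; rewrite ler_norml => /andP[].
apply: (@gronwall_ge R jumps (fun u => dot (D u) (D u))
  (fun s => 2 * dot (D s) (dF s)) a b _ jumps_finite ab _ _ _) => s asb.
- exact: DD_cont.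
- exact: dDD.
- by move=> _; have := DdF asb; rewrite ler_norml => /andP[].
Qed.

End Growth.

(** Over short times the flow is close to the identity in the Lipschitz sense;
    this is what makes it open. *)
Lemma dist_drift x e L y z a b : 0 <= L -> tube_lip x e L -> X y -> X z ->
    0 <= a -> a <= b -> b <= t ->
    (forall s, a < s < b ->
      enorm (xi y s - xi x s) < e /\ enorm (xi z s - xi x s) < e) ->
  enorm (xi y b - xi z b - (xi y a - xi z a)) <=
    L * expR (L * (b - a)) * (b - a) * enorm (xi y a - xi z a).
Proof.
move=> L0 tubeL Xy Xz a0 ab bt close.
set D := fun s => xi y s - xi z s.
rewrite -/(D a) -/(D b); set w := D b - D a; set K := expR _.
have ba : 0 <= b - a by rewrite subr_ge0.
have K0 : 0 <= K by exact: expR_ge0.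
pose C := enorm w * (L * (K * enorm (D a))).
pose f s := C * (s - a) - dot w (D s).
have : f a <= f b.
  apply: (@le_of_derive_ge0_except R jumps f
    (fun s => C - dot w (F (xi y s) (v s) - F (xi z s) (v s))) a b
    jumps_finite ab _ _ _) => s asb.
  - apply: continuousB.
      apply: continuousM; first exact: cst_continuous.
      by apply: continuousB => //; exact: cst_continuous.
    have cw : {for s, continuous (fun=> w)} by exact: cst_continuous.
    exact: (continuous_dot cw (@xi_sub_cont y z s Xy Xz)).
  - move=> nj; have [s0 cv] := cont_at a0 bt asb nj.
    have wD := is_derive_dot (is_derive_cst w s 1) (xi_sub_deriv Xy Xz s0 cv).
    have CD : is_derive s (1 : R) (fun s => C * (s - a)) C.
      have -> : (fun s => C * (s - a)) = C \*: (id - cst a) by [].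
      by apply: is_derive_eq; rewrite subr0 /GRing.scale/= mulr1.
    by apply: is_derive_eq (is_deriveB CD wD) _; rewrite dot0l addr0.
  - move=> _; rewrite subr_ge0; apply: le_trans (cauchy_schwarz _ _) _.
    rewrite ler_wpM2l ?enorm_ge0//.
    have [ys zs] := close s asb; case/andP: asb => as_ sb.
    have s0t : 0 <= s <= t by rewrite (le_trans a0 (ltW as_)) (le_trans (ltW sb)).
    have [_] := tubeL s s0t _ _ ys zs; move=> /le_trans; apply.
    rewrite ler_wpM2l//.
    have close_s u : a < u < s ->
        enorm (xi y u - xi x u) < e /\ enorm (xi z u - xi x u) < e.
      by move=> /andP[au us]; apply: close; rewrite au (lt_trans us).
    have st := le_trans (ltW sb) bt.
    have [+ _] := dist_growth L0 tubeL Xy Xz a0 st close_s (ltW as_).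
    move=> /le_trans; apply; rewrite ler_wpM2r ?enorm_ge0// ler_expR ler_wpM2l//.
    by rewrite lerD2r ltW.
rewrite /f subrr mulr0 sub0r => Hf.
have ww : enorm w * enorm w <= enorm w * (L * K * (b - a) * enorm (D a)).
  rewrite -expr2 enorm_sqr {2}/w dotDr dotNr.
  by rewrite /C in Hf; lra.
have [/enorm_eq0 ->|w0] := eqVneq (enorm w) 0.
  by rewrite enorm0 !mulr_ge0// enorm_ge0.
by rewrite -(@ler_pM2l _ (enorm w))// lt0r w0 enorm_ge0.
Qed.

Definition bilip x d K := forall y z, enorm (y - x) < d -> enorm (z - x) < d ->
  X y /\ forall a b, 0 <= a -> a <= b -> b <= t ->
  [/\ enorm (xi y b - xi z b) <= K * enorm (xi y a - xi z a),
      enorm (xi y a - xi z a) <= K * enorm (xi y b - xi z b) &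
      enorm (xi y b - xi z b - (xi y a - xi z a)) <=
        K * (b - a) * enorm (xi y a - xi z a)].

(** A trajectory that starts close to [x] remains in the tube on which the
    vector field is Lipschitz: the bound [expR (L * t)] on the growth of the
    distance, valid as long as it remains there, prevents it from leaving. *)
Lemma bilip_exists x : X x -> 0 <= t ->
  exists2 d, 0 < d & exists2 K, 1 <= K & bilip x d K.
Proof.
move=> Xx t0.
have [e e0 [L L0 tubeL]] := tube_lip_exists Xx.
have [d1 d10 Hd1] := (nbhs_enormP _ _).1 (open_nbhs_nbhs (conj X_open Xx)).
have Lt : 0 <= L * t by rewrite mulr_ge0.
have eLt : 0 < expR (L * t) by exact: expR_gt0.
have eLt1 : 1 <= expR (L * t) by rewrite -expR0 ler_expR.
pose d := Num.min d1 (e / expR (L * t)).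
have d0 : 0 < d by rewrite lt_min d10 divr_gt0.
have expL a b : 0 <= a -> b <= t -> expR (L * (b - a)) <= expR (L * t).
  by move=> a0 bt; rewrite ler_expR ler_wpM2l// lerBlDr (le_trans bt)// lerDl.
have near_x y : enorm (y - x) < d -> X y /\ forall s, 0 <= s <= t ->
    enorm (xi y s - xi x s) < e.
  rewrite lt_min => /andP[/Hd1 Xy yx]; split=> //; apply: real_induction.
  - by rewrite !xi0// (lt_le_trans yx)// ler_pdivrMr// ler_peMr// ltW.
  - move=> s /andP[s0 st] ys; pose e' := e - enorm (xi y s - xi x s).
    have e'0 : 0 < e' by rewrite subr_gt0.
    have /continuous_enormP/(_ _ e'0)/nbhs_ballP[r /= r0 Hr] := @xi_sub_cont y x s Xy Xx.
    exists r => // u /andP[su usr] ut; have /Hr us : ball s r u.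
      by rewrite /ball/= ltr0_norm ?subr_lt0// opprB ltrBlDl.
    rewrite -[xi y u - _](subrK (xi y s - xi x s)); apply: le_lt_trans (enormD _ _) _.
    by rewrite -ltrBrDr.
  - move=> s /andP[s0 st] ys.
    have close u : 0 < u < s ->
        enorm (xi y u - xi x u) < e /\ enorm (xi x u - xi x u) < e.
      move=> /andP[u0 us]; rewrite subrr enorm0; split=> //.
      by apply: ys; rewrite us ltW.
    have [+ _] := dist_growth L0 tubeL Xy Xx (lexx 0) st close (ltW s0).
    rewrite !xi0// => /le_lt_trans; apply.
    apply: le_lt_trans (_ : expR (L * t) * enorm (y - x) < e).
      by rewrite ler_wpM2r ?enorm_ge0// expL.
    by rewrite mulrC -ltr_pdivlMr.
exists d => //; exists ((1 + L) * expR (L * t)).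
  by rewrite -[leLHS]mulr1 ler_pM// lerDl.
have K1 : expR (L * t) <= (1 + L) * expR (L * t).
  by rewrite ler_peMl ?expR_ge0// lerDl.
move=> y z yx zx; have [Xy ye] := near_x y yx; have [Xz ze] := near_x z zx.
split=> // a b a0 ab bt.
have close s : a < s < b ->
    enorm (xi y s - xi x s) < e /\ enorm (xi z s - xi x s) < e.
  move=> /andP[as_ sb]; have st : 0 <= s <= t.
    by rewrite (le_trans a0 (ltW as_)) (le_trans (ltW sb)).
  by split; [exact: ye|exact: ze].
have Kab := le_trans (expL a b a0 bt) K1.
have [H1 H2] := dist_growth L0 tubeL Xy Xz a0 bt close ab.
split.
- by apply: le_trans H1 _; rewrite ler_wpM2r ?enorm_ge0.
- by apply: le_trans H2 _; rewrite ler_wpM2r ?enorm_ge0.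
apply: le_trans (dist_drift L0 tubeL Xy Xz a0 ab bt close) _.
rewrite ler_wpM2r ?enorm_ge0// ler_wpM2r ?subr_ge0//.
by apply: ler_pM; rewrite ?expR_ge0// ?expL// lerDr.
Qed.

(** Two trajectories that meet at time [s] coincide before [s], by real
    induction in reversed time and the backward Gronwall estimate. *)
Lemma xi_inj x y s : X x -> X y -> 0 <= s <= t -> xi x s = xi y s -> x = y.
Proof.
move=> Xx Xy /andP[s0 st] xys.
have [e e0 [L L0 tubeL]] := tube_lip_exists Xx.
suff H : forall u, 0 <= u <= s -> xi x (s - u) = xi y (s - u).
  by have := H s; rewrite s0 lexx subrr !xi0// => /(_ isT).
apply: real_induction.
- by rewrite subr0.
- move=> u /andP[u0 us] xyu.
  have /continuous_enormP/(_ _ e0)/nbhs_ballP[r /= r0 Hr] := @xi_sub_cont y x (s - u) Xy Xx.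
  exists r => // w /andP[uw wr] ws.
  have sw0 : 0 <= s - w by rewrite subr_ge0.
  have sut : s - u <= t by rewrite (le_trans _ st)// gerBl.
  have swu : s - w <= s - u by rewrite lerB// ltW.
  have close a : s - w < a < s - u ->
      enorm (xi x a - xi x a) < e /\ enorm (xi y a - xi x a) < e.
    move=> /andP[wa au]; rewrite subrr enorm0; split=> //.
    have := Hr a; rewrite xyu subrr subr0; apply.
    by rewrite /ball/= gtr0_norm ?subr_gt0//; lra.
  have [_] := dist_growth L0 tubeL Xx Xy sw0 sut close swu.
  rewrite xyu subrr enorm0 mulr0 => h.
  apply/eqP; rewrite -subr_eq0; apply/eqP/enorm_eq0/le_anti.
  by rewrite h enorm_ge0.
- move=> u /andP[u0 us] H.
  apply/eqP; rewrite -subr_eq0; apply/eqP/enorm_eq0/le_anti.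
  rewrite enorm_ge0 andbT; apply/ler_addgt0Pr => c c0; rewrite add0r.
  have /continuous_enormP/(_ _ c0)/nbhs_ballP[r /= r0 Hr] := @xi_sub_cont x y (s - u) Xx Xy.
  pose w := Num.max 0 (u - r / 2).
  have wu : w < u by rewrite gt_max u0 ltrBlDr ltrDl divr_gt0.
  have w0 : 0 <= w by rewrite le_max lexx.
  have uw : u - r / 2 <= w by rewrite le_max lexx orbT.
  have := Hr (s - w); rewrite (H w) ?w0// subrr sub0r enormN => h; apply/ltW/h.
  by rewrite /ball/= ltr0_norm; lra.
Qed.

End Flow.

(** * Openness of the flow *)

Section Openness.
Context {R : realType} {n : nat} (X : set 'rV[R]_n) (xi : 'rV[R]_n -> R -> 'rV[R]_n).
Context (t : R) (x : 'rV[R]_n) (d K : R).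
Context (xi0 : forall y, X y -> xi y 0 = y) (K_ge1 : 1 <= K)
  (xi_bilip : bilip X xi t x d K).
Implicit Types (y z p : 'rV[R]_n) (s k : R).

Let K_gt0 : 0 < K. Proof. exact: lt_le_trans K_ge1. Qed.

Lemma xi_cont_init y s : enorm (y - x) < d -> 0 <= s <= t ->
  {for y, continuous (xi^~ s)}.
Proof.
move=> yx /andP[s0 st]; apply/continuous_enormP => e e0; apply/nbhs_enormP.
pose r := Num.min (d - enorm (y - x)) (e / K).
exists r; first by rewrite lt_min subr_gt0 yx divr_gt0.
move=> z; rewrite lt_min => /andP[zy1 zy2].
have zx : enorm (z - x) < d.
  by apply: le_lt_trans (enorm_triangle y z x) _; rewrite -ltrBrDr.
have [Xz H] := xi_bilip zx yx; have [Xy _] := xi_bilip yx yx.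
have [+ _ _] := H 0 s (lexx 0) s0 st; rewrite !xi0// => /le_lt_trans; apply.
by rewrite mulrC -ltr_pdivlMr.
Qed.

(** Openness of the flow map at time [s], with a modulus independent of [s]. *)
Definition covers s := forall y k, 0 < k -> enorm (y - x) + k < d ->
  forall p, enorm (p - xi y s) < k / (2 * K) ->
  exists2 z, enorm (z - y) <= k & xi z s = p.

Lemma covers0 : covers 0.
Proof.
move=> y k k0 yk p pk.
have k2K : k / (2 * K) <= k.
  by rewrite ler_pdivrMr ?mulr_gt0// ler_peMr ?ltW//; have := K_ge1; lra.
have yx : enorm (y - x) < d by apply: le_lt_trans yk; rewrite lerDl ltW.
have [Xy _] := xi_bilip yx yx; rewrite xi0// in pk.
have py : enorm (p - y) <= k by rewrite ltW// (lt_le_trans pk).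
exists p => //; have px : enorm (p - x) < d.
  apply: le_lt_trans (enorm_triangle y p x) _; apply: le_lt_trans yk.
  by rewrite addrC lerD2l.
by have [Xp _] := xi_bilip px px; rewrite xi0.
Qed.

(** Let [z] minimise the distance from [xi z s'] to [p] over a closed ball. The
    lower Lipschitz bound keeps [z] away from the boundary. If the minimum were
    positive, openness at time [s] would allow to move [xi z s] a little in the
    direction of [p]; since the flow from [s] to [s'] is close to the identity,
    this would decrease the distance at time [s']. *)
Lemma covers_step s s' : 0 <= s -> s <= s' -> s' <= t -> K * (s' - s) <= 2^-1 ->
  covers s -> covers s'.
Proof.
move=> s0 ss' s't Kss' cov y k k0 yk p pk.
have s'0 : 0 <= s' by exact: le_trans ss'.
have s'0t : 0 <= s' <= t by rewrite s'0.
have in_ball z : enorm (z - y) <= k -> enorm (z - x) < d.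
  move=> zy; apply: le_lt_trans (enorm_triangle y z x) _; apply: le_lt_trans yk.
  by rewrite addrC lerD2l.
pose f z := enorm (xi z s' - p).
have [||z] := @EVT_min_rV R n f (eball y k) _ (@compact_eball R n y k).
- by exists y; rewrite /eball/= subrr enorm0 ltW.
- apply: continuous_in_subspaceT => z; rewrite inE => /in_ball zx.
  have cz := xi_cont_init zx s'0t.
  exact: (continuous_comp cz
    (continuous_comp (@continuous_translate R n p _) (@enorm_continuous R n _))).
rewrite inE /eball/= => zy fmin; exists z => //.
have fmin' u : enorm (u - y) <= k -> f z <= f u by move=> uy; apply: fmin; rewrite inE.
have yx : enorm (y - x) < d by apply: in_ball; rewrite subrr enorm0 ltW.
have fz : f z < k / (2 * K).
  apply: le_lt_trans (fmin' y _) _; first by rewrite subrr enorm0 ltW.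
  by rewrite /f enormC.
have {zy}zy : enorm (z - y) < k.
  rewrite lt_neqAle zy andbT; apply/eqP => zyk.
  have [_ H] := xi_bilip (in_ball z zy) yx.
  have [_ + _] := H 0 s' (lexx 0) s'0 s't.
  have [[Xz _] [Xy _]] := (xi_bilip (in_ball z zy) yx, xi_bilip yx yx).
  rewrite !xi0// zyk => h.
  have := enorm_triangle p (xi z s') (xi y s').
  rewrite -/(f z) => /(ler_wpM2l (ltW K_gt0)); rewrite mulrDr => h'.
  have : K * f z < k / 2.
    by rewrite mulrC -ltr_pdivlMr// -mulrA -invfM.
  have : K * enorm (p - xi y s') < k / 2.
    by rewrite mulrC -ltr_pdivlMr// -mulrA -invfM.
  by lra.
apply/eqP; rewrite -subr_eq0; apply/negPn/negP => pn0.
set w := p - xi z s'.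
have w0 : w != 0 by rewrite -oppr_eq0 opprB.
have w_gt0 : 0 < enorm w by exact: enorm_gt0.
pose k1 := k - enorm (z - y).
have k10 : 0 < k1 by rewrite subr_gt0.
have zk1 : enorm (z - x) + k1 < d.
  apply: le_lt_trans yk; have := enorm_triangle y z x; rewrite /k1; lra.
(* Small enough for openness at time s to reach xi z s + h *: w. *)
pose h := Num.min 1 (k1 / (2 * K) / (2 * enorm w)).
have K20 : 0 < 2 * K by rewrite mulr_gt0.
have h0 : 0 < h by rewrite lt_min ltr01 !divr_gt0// mulr_gt0.
have h1 : h <= 1 by rewrite ge_min lexx.
have [|z2 z2z xiz2] := cov z k1 k10 zk1 (xi z s + h *: w).
  rewrite addrAC subrr add0r enormZ gtr0_norm//.
  have : h <= k1 / (2 * K) / (2 * enorm w) by rewrite ge_min lexx orbT.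
  rewrite ler_pdivlMr ?mulr_gt0//.
  have : 0 < k1 / (2 * K) by rewrite divr_gt0.
  by lra.
have z2y : enorm (z2 - y) <= k.
  by apply: le_trans (enorm_triangle z z2 y) _; move: z2z; rewrite /k1; lra.
have [_ H] := xi_bilip (in_ball z2 z2y) (in_ball z (ltW zy)).
have [_ _ +] := H s s' s0 ss' s't.
rewrite xiz2 [xi z s + _ - _]addrAC subrr add0r enormZ gtr0_norm// => drift.
have {drift}drift : enorm (xi z2 s' - xi z s' - h *: w) <= 2^-1 * (h * enorm w).
  by apply: le_trans drift _; rewrite ler_wpM2r// mulr_ge0 ?ltW.
have := fmin' z2 z2y; rewrite /f.
have -> : xi z2 s' - p = (xi z2 s' - xi z s' - h *: w) - (1 - h) *: w.
  by apply/rowP => i; rewrite /w !mxE; ring.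
rewrite (enormC (xi z s')) -/w => /le_trans/(_ (enormD _ _)).
rewrite enormN enormZ ger0_norm ?subr_ge0// => fle.
have : 0 < h * enorm w by rewrite mulr_gt0.
by lra.
Qed.

Lemma covers_all s : 0 <= s <= t -> covers s.
Proof.
move=> /andP[s0 st].
suff H (k : nat) : forall s, 0 <= s -> s <= t -> s <= k%:R * (2 * K)^-1 -> covers s.
  apply: (H (Num.truncn (s * (2 * K))).+1) => //.
  have sK : 0 <= s * (2 * K) by rewrite mulr_ge0// mulr_ge0// ltW.
  rewrite ler_pdivlMr ?mulr_gt0//.
  by have /andP[_ /ltW] := truncn_itv sK.
elim: k {s s0 st} => [|k IH] s s0 st sk.
  rewrite mul0r in sk; have -> : s = 0 by apply/le_anti/andP.
  exact: covers0.
pose s1 := Num.max 0 (s - (2 * K)^-1).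
have s10 : 0 <= s1 by rewrite le_max lexx.
have K2 : 0 < (2 * K)^-1 by rewrite invr_gt0 mulr_gt0.
have s1s : s1 <= s by rewrite ge_max s0 gerBl ltW.
have ss1 : s - (2 * K)^-1 <= s1 by rewrite le_max lexx orbT.
apply: (@covers_step s1) => //.
  apply: (@le_trans _ _ (K * (2 * K)^-1)); first by rewrite ler_pM2l//; lra.
  by rewrite invfM mulrCA divff ?mulr1// gt_eqF.
apply: IH => //; first exact: le_trans st.
rewrite ge_max mulr_ge0 ?ler0n ?(ltW K2)//=.
by move: sk; rewrite -natr1 mulrDl mul1r; lra.
Qed.

End Openness.

(** * Second-order Taylor bound *)

Section Taylor.
Context {R : realType} {n m : nat} (X : set 'rV[R]_n) (V : set 'rV[R]_m)
  (F : 'rV[R]_n -> 'rV[R]_m -> 'rV[R]_n).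
Context (F_C1 : C1_fst X V F).

(** The quotient in [D1_limsup] is multiplied out, so that [h = 0], excluded
    from the punctured neighbourhood, is covered too. *)
Lemma D1_limsup_near x w (M e : R) : (D1_limsup F x w <= M%:E)%E -> 0 < e ->
  exists2 d, 0 < d & forall h, enorm h < d ->
    opnorm (D1 F (x + h) w - D1 F x w) <= (M + e) * enorm h.
Proof.
move=> HM e0; have [W W0 HW] := limf_esup_le_near HM e0.
have [d d0 Hd] := (nbhs_enormP _ _).1 W0.
exists d => // h hd; have [->|h0] := eqVneq h 0.
  rewrite enorm0 mulr0 addr0 subrr /opnorm.
  apply: ge_sup => [|_ [k _ <-]]; last by rewrite mulmx0 enorm0.
  by exists 0; exists 0; rewrite /= ?mul0mx enorm0// ler01.
rewrite -ler_pdivrMr ?enorm_gt0// -lee_fin; apply: HW.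
by apply: (Hd h) => //=; rewrite subr0.
Qed.

Context (a d : 'rV[R]_n) (w : 'rV[R]_m) (M : R) (Vw : V w).
Context (seg_X : forall s : R, 0 <= s <= 1 -> X (a + s *: d)).
Context (seg_M : forall s : R, 0 <= s <= 1 ->
  (D1_limsup F (a + s *: d) w <= M%:E)%E).

Let D s := D1 F (a + s *: d) w.

Let D_lip (s : R) (e : R) : 0 <= s <= 1 -> 0 < e -> exists2 r, 0 < r &
  forall s', `|s' - s| < r ->
    forall u, dot u (d *m (D s' - D s)) <=
      enorm u * ((M + e) * `|s' - s| * dot d d).
Proof.
move=> s01 e0; have [r r0 Hr] := D1_limsup_near (seg_M s01) e0.
have d1 : 0 < enorm d + 1 by rewrite ltr_wpDl// enorm_ge0.
exists (r / (enorm d + 1)); first by rewrite divr_gt0.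
move=> s'; rewrite ltr_pdivlMr// => s's u.
apply: le_trans (cauchy_schwarz _ _) _; rewrite ler_wpM2l ?enorm_ge0//.
apply: le_trans (enorm_mulmx_le_opnorm _ _) _.
have := Hr ((s' - s) *: d); rewrite enormZ.
have -> : a + s *: d + (s' - s) *: d = a + s' *: d.
  by apply/rowP => i; rewrite !mxE; ring.
move=> /(_ _)/(ler_wpM2r (enorm_ge0 d)) H.
rewrite -enorm_sqr expr2 -!mulrA !mulrA; move: H; rewrite !mulrA; apply.
by apply: le_lt_trans s's; rewrite ler_wpM2l// lerDl.
Qed.

(** The function [k] is the variation of the derivative along the segment. Its
    pointwise Lipschitz constants are at most [c], hence [k s <= c * s] by the
    Dini criterion; integrating once more gives the factor 1/2. *)
Lemma taylor_le u : dot u (F (a + d) w - F a w - d *m D1 F a w) <=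
  enorm u * (M / 2 * dot d d).
Proof.
pose c := enorm u * (M * dot d d).
pose k (s : R) := dot u (d *m (D s - D 0)).
have k_lip s e : 0 <= s <= 1 -> 0 < e -> exists2 r, 0 < r &
    forall s', `|s' - s| < r ->
    `|k s' - k s| <= (c + e) * `|s' - s|.
  move=> s01 e0; pose B := enorm u * dot d d + 1.
  have B0 : 0 < B by rewrite ltr_wpDl// mulr_ge0 ?enorm_ge0 ?dot_ge0.
  have eB : 0 < e / B by rewrite divr_gt0.
  have [r r0 Hr] := D_lip s01 eB; exists r => // s' s's.
  have kE : k s' - k s = dot u (d *m (D s' - D s)).
    by rewrite /k -dotNr -dotDr -mulmxN -mulmxDr opprB addrA subrK.
  have bound : enorm u * ((M + e / B) * `|s' - s| * dot d d) <=
      (c + e) * `|s' - s|.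
    rewrite (_ : _ * _ = (c + e / B * (B - 1)) * `|s' - s|); last first.
      by rewrite /c /B; ring.
    rewrite ler_wpM2r// lerD2l mulrBr mulr1 divfK ?gt_eqF// gerBl.
    exact: ltW.
  rewrite kE; apply/ler_normlP; split; last exact: le_trans (Hr _ s's _) bound.
  by rewrite -dotNl; apply: le_trans (Hr _ s's _) _; rewrite enormN.
pose f s := c * s - k s.
have f_cont s : 0 <= s <= 1 -> {for s, continuous f}.
  move=> s01; apply: continuousB.
    apply: continuousM; first exact: cst_continuous.
    by move=> B.
  have [r r0 Hr] := k_lip s 1 s01 ltr01.
  apply/cvgrPdist_lt => e e0; apply/nbhs_ballP.
  have c1 : 0 < `|c + 1| + 1 by rewrite ltr_wpDl.
  exists (Num.min r (e / (`|c + 1| + 1))) => /=; first by rewrite lt_min r0 divr_gt0.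
  move=> s'; rewrite /ball/= distrC lt_min => /andP[s'r s'e].
  rewrite distrC; apply: le_lt_trans (Hr _ s'r) _.
  move: s'e; rewrite ltr_pdivlMr// mulrC; apply: le_lt_trans.
  by rewrite ler_wpM2r// (le_trans (ler_norm _))// lerDl.
have kle s : 0 <= s <= 1 -> k s <= c * s.
  move=> /andP[s0 s1]; suff : f 0 <= f s.
    rewrite /f mulr0 {1}/k subrr mulmx0 dot0r subr0; lra.
  apply: le_of_right_dini_ge0 => // u' /andP[u0 us].
    by apply: f_cont; rewrite u0 (le_trans us).
  move=> e e0; have u'01 : 0 <= u' <= 1 by rewrite ltW// (le_trans (ltW us)).
  have [r r0 Hr] := k_lip u' e u'01 e0; exists r => // y /andP[uy yr].
  have yu : 0 < y - u' by rewrite subr_gt0.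
  have := Hr y; rewrite gtr0_norm// ltrBlDl => /(_ yr).
  rewrite ler_norml => /andP[_].
  have aux (p q r1 r2 C e1 : R) : q - p <= (C + e1) * (r2 - r1) ->
      C * r1 - p - e1 * (r2 - r1) <= C * r2 - q by lra.
  exact: aux.
pose beta := dot u (d *m D1 F a w).
pose g (s : R) := s * (c / 2 * s + beta) - dot u (F (a + s *: d) w).
have D0 : D 0 = D1 F a w by rewrite /D scale0r addr0.
have kE (s : R) : k s = dot u (d *m D s) - beta.
  by rewrite /k D0 mulmxBr dotDr dotNr.
have gD (s : R) : 0 <= s <= 1 -> is_derive s (1 : R) g (c * s - k s).
  move=> s01; have FD := is_derive_line F_C1 (seg_X s01) Vw.
  have uD := is_derive_dot (is_derive_cst u s 1) FD.
  have lD : is_derive s (1 : R) (fun s : R => c / 2 * s + beta) (c / 2).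
    have -> : (fun s : R => c / 2 * s + beta) = (c / 2) \*: id + cst beta by [].
    by apply: is_derive_eq; rewrite addr0 /GRing.scale/= mulr1.
  apply: is_derive_eq (is_deriveB (is_deriveM (is_derive_id s 1) lD) uD) _.
  rewrite (kE s) (dot0l (F (a + s *: d) w)) addr0.
  have aux (p q r1 C : R) : r1 * (C / 2) + (C / 2 * r1 + p) * 1 - q =
    C * r1 - (q - p) by field.
  exact: (aux beta (dot u (d *m D s)) s c).
have : g 0 <= g 1.
  apply: (@le_of_derive_ge0_except R set0 g (fun s : R => c * s - k s) 0 1
    (finite_set0 _) ler01 _ _ _) => s.
  - by move=> s01; exact: is_derive_continuous (gD s s01).
  - by move=> /andP[s0 s1] _; apply: gD; rewrite !ltW.
  - by move=> /andP[s0 s1] _; rewrite subr_ge0; apply: kle; rewrite !ltW.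
rewrite /g mul0r sub0r scale0r addr0 mulr1 mul1r scale1r.
rewrite (dotDr _ _ u) (dotDr _ _ u) !(dotNr _ u) -/beta.
have aux (p q b0 C : R) : - p <= C / 2 + b0 - q -> q - p - b0 <= C / 2 by lra.
move=> /aux/le_trans; apply; rewrite /c.
have aux2 (p q r1 : R) : p * (q * r1) / 2 = p * (q / 2 * r1) by field.
by rewrite aux2.
Qed.


End Taylor.

(** * A primitive of the exponential *)

Section ExpPrimitive.
Context {R : realType}.
Implicit Types c s t : R.

Definition exp_primitive c s : R := if c == 0 then s else (expR (c * s) - 1) / c.

Lemma exp_primitive0 c : exp_primitive c 0 = 0.
Proof. by rewrite /exp_primitive mulr0 expR0 subrr mul0r if_same. Qed.

Lemma is_derive_exp_primitive c s :
  is_derive s (1 : R) (exp_primitive c) (expR (c * s)).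
Proof.
have [c0|c0] := eqVneq c 0.
  have E : exp_primitive 0 = id by apply/funext => u; rewrite /exp_primitive eqxx.
  by rewrite c0 mul0r expR0 E; exact: is_derive_id.
have E : exp_primitive c = c^-1 \*: ((fun u => expR (c * (u - 0))) - cst 1).
  by apply/funext => u; rewrite /exp_primitive (negbTE c0) mulrC -[u in LHS]subr0.
rewrite E; have eD := is_derive_exp_affine c 0 s.
by apply: is_derive_eq; rewrite !subr0 /GRing.scale/= mulrA mulVf// mul1r.
Qed.

Lemma exp_primitive_le c s t : s <= t -> exp_primitive c s <= exp_primitive c t.
Proof.
move=> st; apply: (@le_of_derive_ge0_except R set0 (exp_primitive c)
  (fun u => expR (c * u)) s t (finite_set0 _) st _ _ _) => u _.
- exact: is_derive_continuous (is_derive_exp_primitive c u).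
- by move=> _; exact: is_derive_exp_primitive.
- by rewrite expR_ge0.
Qed.

Lemma Rintegral_expR c t : 0 < t ->
  \int[lebesgue_measure]_(u in `[0, t]) expR (c * u) = exp_primitive c t.
Proof.
move=> t0; rewrite /Rintegral.
have H u : {for u, continuous (exp_primitive c)}.
  exact: is_derive_continuous (is_derive_exp_primitive c u).
rewrite (@continuous_FTC2 _ _ (exp_primitive c) 0 t t0).
- by rewrite exp_primitive0 sube0.
- apply: continuous_subspaceT => u.
  have E : (fun u => expR (c * (u - 0))) = (fun u : R => expR (c * u)).
    by apply/funext => w; rewrite subr0.
  by have := is_derive_continuous (is_derive_exp_affine c 0 u); rewrite E.
- split.
  + by move=> u _; have [] := is_derive_exp_primitive c u.
  + exact: cvg_at_right_filter (H 0).
  + exact: cvg_at_left_filter (H t).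
- move=> u _; rewrite derive1E.
  by have [_ ->] := is_derive_exp_primitive c u.
Qed.

End ExpPrimitive.

(** * Comparison for the quotient of second by first differences *)

(** The vector [q] is bounded below in growth by the rate [mu], the scalar [S]
    above by the rate [2 nu + eta], and the forcing of [q] is at most
    [M2 / 2 * S]. Thus [H], built from [|q| / S] and the integrating factor, is
    nondecreasing: where [q] does not vanish by differentiation, and where [q]
    vanishes because the first summand of [H] attains its minimum 0 there. *)
Section RatioEstimate.
Context {R : realType} {n : nat}.
Context (M1 M2 eta tau : R) (M2_ge0 : 0 <= M2) (eta_ge0 : 0 <= eta)
  (tau_ge0 : 0 <= tau) (E : set R) (E_finite : finite_set E).
Context (q dq : R -> 'rV[R]_n) (S dS mu nu : R -> R).
Context (q_cont : forall s, 0 <= s <= tau -> {for s, continuous q})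
  (S_cont : forall s, 0 <= s <= tau -> {for s, continuous S})
  (S_gt0 : forall s, 0 <= s <= tau -> 0 < S s).
Context (q_deriv : forall s, 0 < s < tau -> ~ E s -> is_derive s (1 : R) q (dq s))
  (S_deriv : forall s, 0 < s < tau -> ~ E s -> is_derive s (1 : R) S (dS s)).
Context (q_growth : forall s, 0 < s < tau -> ~ E s ->
    mu s * enorm (q s) ^+ 2 - enorm (q s) * (M2 / 2 * S s) <= dot (q s) (dq s))
  (S_growth : forall s, 0 < s < tau -> ~ E s -> dS s <= (2 * nu s + eta) * S s)
  (gap_le : forall s, 0 < s < tau -> ~ E s -> 2 * nu s - mu s <= M1).

Let ratio_deriv_ge (Q Sv P S' a b : R) : 0 < Q -> 0 < Sv ->
  a * Q ^+ 2 - Q * (M2 / 2 * Sv) <= P -> S' <= (2 * b + eta) * Sv ->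
  2 * b - a <= M1 ->
  - (M2 / 2) <= (M1 + eta) * (Q / Sv) + (P / (Q * Sv) - Q * S' / Sv ^+ 2).
Proof.
move=> Q0 S0 HP HS' Hmu.
have h1 : a * (Q / Sv) - M2 / 2 <= P / (Q * Sv).
  rewrite ler_pdivlMr ?mulr_gt0//; apply: le_trans HP.
  by rewrite le_eqVlt; apply/orP; left; apply/eqP; field; rewrite gt_eqF.
have h2 : Q * S' / Sv ^+ 2 <= (2 * b + eta) * (Q / Sv).
  rewrite ler_pdivrMr ?exprn_gt0//.
  have -> : (2 * b + eta) * (Q / Sv) * Sv ^+ 2 = Q * ((2 * b + eta) * Sv).
    by field; rewrite gt_eqF.
  by rewrite ler_pM2l.
have h3 : 0 <= (M1 - (2 * b - a)) * (Q / Sv).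
  by rewrite mulr_ge0 ?subr_ge0// ltW// divr_gt0.
by move: h1 h2 h3; lra.
Qed.

Let k := M2 / 2 * expR (eta * tau).
Let J s := k * exp_primitive M1 s.
Let H s := expR ((M1 + eta) * (s - 0)) * (Num.sqrt (dot (q s) (q s)) * (S s)^-1) + J s.

Let k_ge0 : 0 <= k. Proof. by rewrite !mulr_ge0// expR_ge0. Qed.

Let J_le a b : a <= b -> J a <= J b.
Proof. by move=> ab; rewrite ler_wpM2l// exp_primitive_le. Qed.

Let H_cont s : 0 <= s <= tau -> {for s, continuous H}.
Proof.
move=> st; have cq := q_cont st; have Ss : S s != 0 by rewrite gt_eqF// S_gt0.
apply: continuousD.
  apply: continuousM.
    exact: is_derive_continuous (is_derive_exp_affine _ _ _).
  apply: continuousM; last by apply: continuousV => //; exact: S_cont.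
  exact: (continuous_comp (continuous_dot cq cq) (@sqrt_continuous R _)).
apply: continuousM; first exact: cst_continuous.
exact: is_derive_continuous (is_derive_exp_primitive _ _).
Qed.

Let H_dini s : 0 < s < tau -> ~ E s -> right_dini_ge0 H s.
Proof.
move=> sint nE; have /andP[s0 stau] := sint.
have [q0|qn0] := eqVneq (q s) 0.
  move=> e e0; exists (tau - s); first by rewrite subr_gt0.
  move=> u /andP[su ut]; have utau : u < tau by move: ut; rewrite addrC subrK.
  have Hs : H s = J s by rewrite /H q0 dot0l sqrtr0 mul0r mulr0 add0r.
  have Hu : J u <= H u.
    rewrite /H lerDr mulr_ge0 ?expR_ge0// mulr_ge0 ?sqrtr_ge0// invr_ge0 ltW//.
    by apply: S_gt0; rewrite (le_trans (ltW s0) (ltW su)) ltW.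
  rewrite Hs; apply: le_trans Hu; apply: le_trans (J_le (ltW su)).
  by rewrite gerBl mulr_ge0 ?ltW// subr_gt0.
have Ss : 0 < S s by apply: S_gt0; rewrite !ltW.
have Q0 : 0 < enorm (q s) by exact: enorm_gt0.
have qD := q_deriv sint nE; have SD := S_deriv sint nE.
have qqD : is_derive s (1 : R) (fun u => dot (q u) (q u)) (2 * dot (q s) (dq s)).
  apply: is_derive_eq (is_derive_dot qD qD) _.
  by rewrite (dotC (dq s)) mulr_natl mulr2n.
have sqD := is_derive1_comp (is_derive1_sqrt (dot_gt0 qn0)) qqD.
have SVD := is_deriveV (lt0r_neq0 Ss) SD.
have ZD := is_deriveM sqD SVD.
have eD := is_derive_exp_affine (M1 + eta) 0 s.
have JD := is_deriveZ k (is_derive_exp_primitive M1 s).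
have HD : is_derive s (1 : R) H _ := is_deriveD (is_deriveM eD ZD) JD.
apply: (derive_ge0_right_dini HD).
have -> : ((Num.sqrt \o (fun u => dot (q u) (q u))) * (fun y => (S y)^-1)) s =
    enorm (q s) * (S s)^-1 by rewrite enormE.
rewrite /= -enormE subr0.
have valE (e A Q P Sv S' b : R) : 0 < Q -> 0 < Sv ->
    e * (Q * (- Sv ^- 2 * S') + Sv^-1 * ((2 * Q)^-1 * (2 * P))) +
      Q * Sv^-1 * (A * e) + b =
    e * (A * (Q / Sv) + (P / (Q * Sv) - Q * S' / Sv ^+ 2)) + b.
  by move=> Q_gt0 Sv_gt0; field; rewrite !gt_eqF.
rewrite /GRing.scale/= valE//.
have := ratio_deriv_ge Q0 Ss (q_growth sint nE) (S_growth sint nE) (gap_le sint nE).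
set W := _ * (_ / _) + _ => WM.
apply: (@le_trans _ _ (expR ((M1 + eta) * s) * - (M2 / 2) + k * expR (M1 * s))).
  rewrite /k mulrDl expRD mulrN addrC subr_ge0 mulrC -!mulrA.
  rewrite ler_wpM2l ?ler_wpM2l ?invr_ge0// mulrC ler_wpM2r ?expR_ge0//.
  by rewrite ler_expR ler_wpM2l// ltW.
by rewrite lerD2r ler_wpM2l ?expR_ge0.
Qed.

Lemma ratio_estimate : q tau = 0 ->
  enorm (q 0) <= M2 / 2 * expR (eta * tau) * exp_primitive M1 tau * S 0.
Proof.
move=> q_end.
have := le_of_right_dini_ge0_except E_finite tau_ge0 H_cont H_dini.
rewrite /H /J exp_primitive0 !mulr0 subr0 mulr0 expR0 mul1r addr0 q_end dot0l.
rewrite sqrtr0 mul0r mulr0 add0r -enormE ler_pdivrMr//.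
by apply: S_gt0; rewrite lexx.
Qed.

End RatioEstimate.

(** * The three-point estimate *)

Section Curvature.
Context {R : realType} {n m : nat} (X : set 'rV[R]_n) (V : set 'rV[R]_m)
  (F : 'rV[R]_n -> 'rV[R]_m -> 'rV[R]_n) (T : R) (U : set (R -> 'rV[R]_m)).
Context (X_open : open X) (F_C1 : C1_fst X V F) (T_gt0 : 0 < T)
  (U_pc : forall u, U u -> piecewise_continuous T V u).
Context (v : R -> 'rV[R]_m) (v_adm : admissible T U v).
Context (xi : 'rV[R]_n -> R -> 'rV[R]_n).
Implicit Types (x y z : 'rV[R]_n) (a b c d e s : R).
Context (xi0 : forall x, X x -> xi x 0 = x)
  (xi_X : forall x s, X x -> X (xi x s))
  (xi_cont : forall x, X x -> continuous (xi x))
  (xi_deriv : forall x s, X x -> 0 < s -> {for s, continuous v} ->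
    is_derive s (1 : R) (xi x) (F (xi x s) (v s))).
Context (t M1 M2 : R) (Y : set 'rV[R]_n) (Y_X : Y `<=` X).
Context (M1_ge : forall x w, Y x -> V w ->
  2 * mu_max (D1 F x w) - mu_min (D1 F x w) <= M1).
Context (M2_ge : forall x w, Y x -> V w -> (D1_limsup F x w <= M2%:E)%E).

Let rem_le x h w e u : enorm h < e -> (forall p, enorm (p - x) < e -> Y p) ->
  V w -> dot u (F (x + h) w - F x w - h *m D1 F x w) <=
    enorm u * (M2 / 2 * dot h h).
Proof.
move=> he Ye Vw.
have YY s : 0 <= s <= 1 -> Y (x + s *: h).
  move=> /andP[s0 s1]; apply: Ye; rewrite addrAC subrr add0r enormZ ger0_norm//.
  by apply: le_lt_trans he; rewrite ler_piMl ?enorm_ge0.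
apply: (taylor_le F_C1 Vw) => s s01; first exact/Y_X/YY.
by apply: M2_ge => //; exact: YY.
Qed.

(** [ratio_estimate] for the second difference [q] of three trajectories and
    the sum [S] of the squares of the first differences. The hypothesis on
    [e0] makes the Taylor bound available on the segments from the middle
    trajectory to the outer ones. *)
Lemma three_point_estimate x e0 tau (K : R) : X x -> 0 < e0 -> 0 <= tau <= t ->
    (forall s, 0 <= s <= t -> forall p, enorm (p - xi x s) < e0 -> Y p) ->
    1 < K ->
  exists2 d, 0 < d & forall z1 z2,
    enorm (z1 - x) < d -> enorm (z2 - x) < d ->
    xi z1 tau + xi z2 tau = 2 *: xi x tau ->
    enorm (z1 - x + (z2 - x)) <= K * (M2 / 2) * exp_primitive M1 t *
      (dot (z1 - x) (z1 - x) + dot (z2 - x) (z2 - x)).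
Proof.
move=> Xx e00 /andP[tau0 taut] Ye K1.
have t0 : 0 <= t by exact: le_trans taut.
have [d1 d10 [B B1 bil]] := bilip_exists X_open F_C1 T_gt0 U_pc v_adm xi0 xi_X
  xi_cont xi_deriv Xx t0.
have B0 : 0 < B by exact: lt_le_trans B1.
have lnK_gt0 : 0 < ln K by rewrite ln_gt0.
have M2t : 0 < `|M2| * t + 1 by rewrite ltr_wpDl// mulr_ge0.
(* With |xi zi - xi x| < e the cubic error terms raise the growth rate of S by at
   most M2 * e, which costs a factor expR (M2 * e * t) <= K. *)
pose e := Num.min e0 (ln K / (`|M2| * t + 1)).
have e_gt0 : 0 < e by rewrite lt_min e00 ?divr_gt0.
have expK : expR (`|M2| * e * t) <= K.
  rewrite -[leRHS]lnK ?posrE ?(lt_trans _ K1)// ler_expR.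
  have : e * (`|M2| * t + 1) <= ln K.
    by rewrite -ler_pdivlMr// ge_min lexx orbT.
  have := e_gt0; lra.
pose d := Num.min d1 (e / B).
have d_gt0 : 0 < d by rewrite lt_min d10 divr_gt0.
exists d => // z1 z2 z1d z2d mid.
pose S0 := dot (z1 - x) (z1 - x) + dot (z2 - x) (z2 - x).
have [S00|S0n] := eqVneq S0 0.
  have [z10 z20] : z1 - x = 0 /\ z2 - x = 0.
    have := dot_ge0 (z1 - x); have := dot_ge0 (z2 - x); move: S00; rewrite /S0.
    by move=> h h1 h2; split; apply: dot_eq0; lra.
  by rewrite z10 z20 addr0 enorm0 !dot0l addr0 mulr0.
have S0_gt0 : 0 < S0 by rewrite lt0r S0n addr_ge0 ?dot_ge0.
pose D z s := xi z s - xi x s.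
have xd1 : enorm (x - x) < d1 by rewrite subrr enorm0.
have Dprop z : enorm (z - x) < d -> [/\ X z, D z 0 = z - x &
    forall s, 0 <= s <= t -> enorm (D z s) < e /\
      dot (z - x) (z - x) <= B ^+ 2 * dot (D z s) (D z s)].
  rewrite lt_min => /andP[zd1 zdB]; have [Xz H] := bil z x zd1 xd1.
  split=> //; first by rewrite /D !xi0.
  move=> s /andP[s0 st]; have [h1 h2 _] := H 0 s (lexx 0) s0 st.
  rewrite !xi0// in h1 h2; split.
    by apply: le_lt_trans h1 _; rewrite mulrC -ltr_pdivlMr.
  rewrite -!enorm_sqr -exprMn ler_pXn2r ?nnegrE ?enorm_ge0//.
  by rewrite mulr_ge0 ?enorm_ge0// ltW.
have [Xz1 D10 H1] := Dprop z1 z1d; have [Xz2 D20 H2] := Dprop z2 z2d.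
pose q s := D z1 s + D z2 s.
pose S s := dot (D z1 s) (D z1 s) + dot (D z2 s) (D z2 s).
have S_gt0 s : 0 <= s <= t -> 0 < S s.
  move=> st; have [_ h1] := H1 s st; have [_ h2] := H2 s st.
  have : 0 < B ^+ 2 * S s.
    by apply: lt_le_trans S0_gt0 _; rewrite mulrDr lerD.
  by rewrite pmulr_rgt0// exprn_gt0.
have Ds_e0 z s : enorm (D z s) < e -> enorm (D z s) < e0.
  by move/lt_le_trans; apply; rewrite ge_min lexx.
have v_V s : 0 <= s -> V (v s) by exact: (admissible_val T_gt0 U_pc v_adm).
pose G z s := F (xi z s) (v s) - F (xi x s) (v s).
pose A s := D1 F (xi x s) (v s).
have G_rem z s u : 0 <= s <= t -> enorm (D z s) < e ->
    dot u (G z s - D z s *m A s) <= enorm u * (M2 / 2 * dot (D z s) (D z s)).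
  move=> st De; have /andP[s0 _] := st.
  have := rem_le u (Ds_e0 _ _ De) (Ye s st) (v_V s s0).
  by rewrite (_ : xi x s + D z s = xi z s)// /D addrC subrK.
(* The Taylor bound in the directions D z 0 and - D z 0 forces M2 >= 0. *)
have M2_ge0 : 0 <= M2.
  have tt : 0 <= (0 : R) <= t by rewrite lexx.
  have [De1 _] := H1 0 tt; have [De2 _] := H2 0 tt.
  have aux z : enorm (D z 0) < e -> D z 0 != 0 -> 0 <= M2.
    move=> De Dn0; have h1 := G_rem z 0 (D z 0) tt De.
    have := G_rem z 0 (- D z 0) tt De; rewrite dotNl enormN => h2.
    have : 0 <= enorm (D z 0) * (M2 / 2 * dot (D z 0) (D z 0)) by lra.
    by rewrite pmulr_rge0 ?enorm_gt0// pmulr_lge0 ?dot_gt0// pmulr_lge0.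
  have [z10|] := eqVneq (D z1 0) 0; last exact: aux.
  have [z20|] := eqVneq (D z2 0) 0; last exact: aux.
  by move: S0_gt0; rewrite /S0 -D10 -D20 z10 z20 dot0l addr0 ltxx.
pose eta := M2 * e.
have eta0 : 0 <= eta by rewrite mulr_ge0// ltW.
have etaK : expR (eta * t) <= K by move: expK; rewrite ger0_norm.
have D_cont z s : X z -> {for s, continuous (D z)}.
  by move=> Xz; exact: (@xi_sub_cont R n X xi xi_cont z x s Xz Xx).
have D_deriv z s : X z -> 0 < s -> {for s, continuous v} ->
    is_derive s (1 : R) (D z) (G z s).
  by move=> Xz; exact: (xi_sub_deriv xi_deriv Xz Xx).
have q_cont s : {for s, continuous q}.
  by apply: continuousD; exact: D_cont.
have S_cont s : {for s, continuous S}.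
  have c1 := D_cont z1 s Xz1; have c2 := D_cont z2 s Xz2.
  by apply: continuousD; [exact: (continuous_dot c1 c1) | exact: (continuous_dot c2 c2)].
have jumps_cont s : 0 < s < tau -> ~ jumps v t s ->
    [/\ 0 < s, 0 <= s <= t & {for s, continuous v}].
  move=> /andP[s0 stau] nj; rewrite (ltW s0) (le_trans (ltW stau))//; split=> //.
  apply: contrapT => ncv; apply: nj; split=> //.
  by rewrite s0 (lt_le_trans stau).
have Y_xi s : 0 <= s <= t -> Y (xi x s).
  by move=> st; apply: (Ye s st); rewrite subrr enorm0.
have split_rem z s u : dot u (G z s) = dot u (D z s *m A s) +
    dot u (G z s - D z s *m A s).
  by rewrite -dotDr addrC subrK.
have := @ratio_estimate R n M1 M2 eta tau M2_ge0 eta0 tau0 (jumps v t)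
  (admissible_discontinuities T_gt0 U_pc v_adm t)
  q (fun s => G z1 s + G z2 s) S
  (fun s => 2 * (dot (D z1 s) (G z1 s) + dot (D z2 s) (G z2 s)))
  (fun s => mu_min (A s)) (fun s => mu_max (A s)).
have q0E : q 0 = z1 - x + (z2 - x) by rewrite /q D10 D20.
have S0E : S 0 = S0 by rewrite /S D10 D20.
rewrite q0E S0E => est.
apply: le_trans (est _ _ _ _ _ _ _ _ _) _.
- by move=> s _; exact: q_cont.
- by move=> s _; exact: S_cont.
- by move=> s /andP[s0 st]; apply: S_gt0; rewrite s0 (le_trans st).
- move=> s sint /(jumps_cont s sint)[s0 st cv].
  exact: (is_deriveD (D_deriv z1 s Xz1 s0 cv) (D_deriv z2 s Xz2 s0 cv)).
- move=> s sint /(jumps_cont s sint)[s0 st cv].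
  have D1s := D_deriv z1 s Xz1 s0 cv; have D2s := D_deriv z2 s Xz2 s0 cv.
  apply: is_derive_eq (is_deriveD (is_derive_dot D1s D1s) (is_derive_dot D2s D2s)) _.
  have aux (p p' r r' : R) : p = p' -> r = r' -> p + p' + (r + r') = 2 * (p + r).
    by move=> <- <-; ring.
  by apply: aux; exact: dotC.
- move=> s sint /(jumps_cont s sint)[s0 st cv].
  have [De1 _] := H1 s st; have [De2 _] := H2 s st.
  have r1 := G_rem z1 s (- q s) st De1; have r2 := G_rem z2 s (- q s) st De2.
  have := mu_min_le_dot_mulmx (q s) (A s).
  rewrite enormN in r1; rewrite enormN in r2.
  rewrite (dotNl (q s)) in r1; rewrite (dotNl (q s)) in r2.
  have -> : dot (q s) (q s *m A s) =
      dot (q s) (D z1 s *m A s) + dot (q s) (D z2 s *m A s).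
    by rewrite {2}/q mulmxDl (dotDr (D z1 s *m A s)).
  rewrite enorm_sqr (dotDr (G z1 s) (G z2 s)) (split_rem z1) (split_rem z2) /S.
  have aux (p p1 p2 g1 g2 Q u1 u2 a : R) : - g1 <= Q * (a * u1) ->
      - g2 <= Q * (a * u2) -> p <= p1 + p2 ->
      p - Q * (a * (u1 + u2)) <= p1 + g1 + (p2 + g2) by lra.
  exact: aux.
- move=> s sint /(jumps_cont s sint)[s0 st cv].
  have [De1 _] := H1 s st; have [De2 _] := H2 s st.
  have le1 z : enorm (D z s) < e -> dot (D z s) (G z s) <=
      (mu_max (A s) + eta / 2) * dot (D z s) (D z s).
    move=> De; rewrite split_rem.
    have h1 := dot_mulmx_le_mu_max (D z s) (A s).
    have h2 := G_rem z s (D z s) st De.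
    have h3 : enorm (D z s) * (M2 / 2 * dot (D z s) (D z s)) <=
        e * (M2 / 2 * dot (D z s) (D z s)).
      apply: ler_wpM2r; last exact: ltW.
      by rewrite mulr_ge0 ?dot_ge0// divr_ge0.
    have aux (g1 g2 nu u Q a e1 : R) : g1 <= nu * u -> g2 <= Q * (a / 2 * u) ->
        Q * (a / 2 * u) <= e1 * (a / 2 * u) -> g1 + g2 <= (nu + a * e1 / 2) * u.
      by lra.
    exact: aux h1 h2 h3.
  have h1 := le1 z1 De1; have h2 := le1 z2 De2; rewrite /S.
  have aux (g1 g2 nu u1 u2 a : R) : g1 <= (nu + a / 2) * u1 ->
      g2 <= (nu + a / 2) * u2 -> 2 * (g1 + g2) <= (2 * nu + a) * (u1 + u2) by lra.
  exact: aux.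
- move=> s sint /(jumps_cont s sint)[s0 st cv].
  by apply: M1_ge; [exact: Y_xi | exact/v_V/ltW].
- by rewrite /q /D addrACA mid -opprD -mulr2n scaler_nat subrr.
have I_tau : 0 <= exp_primitive M1 tau.
  by rewrite -(exp_primitive0 M1) exp_primitive_le.
rewrite -/S0; apply: (ler_wpM2r (ltW S0_gt0)); apply: ler_pM => //.
- by rewrite !mulr_ge0// expR_ge0.
- rewrite mulrC ler_wpM2r ?divr_ge0//; apply: le_trans etaK.
  by rewrite ler_expR ler_wpM2l.
- exact: exp_primitive_le.
Qed.

End Curvature.

(** * The general solution as a flow *)

(** The general solution is extended to negative times by its initial value, so
    that trajectories are continuous on the whole line. *)
Section GeneralSolution.
Context {R : realType} {n m : nat} (X : set 'rV[R]_n) (V : set 'rV[R]_m)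
  (F : 'rV[R]_n -> 'rV[R]_m -> 'rV[R]_n) (T : R) (U : set (R -> 'rV[R]_m)).
Context (F_global : forall x0 v, X x0 -> admissible T U v ->
  exists x, is_solution X F x0 v x).
Context (v : R -> 'rV[R]_m) (v_adm : admissible T U v).

Let xi x s := general_solution X F (Num.max 0 s) x v.

Let sol x := xget (cst 0) [set y | is_solution X F x v y].

Let solP x : X x -> is_solution X F x v (sol x).
Proof. by move=> Xx; exact: (xgetPex _ (F_global Xx v_adm)). Qed.

Lemma general_solution_ge0 x s : 0 <= s -> xi x s = general_solution X F s x v.
Proof. by move=> s0; rewrite /xi max_r. Qed.

Lemma general_solution0 x : X x -> xi x 0 = x.
Proof. by move=> /solP[? _ _ _]; rewrite general_solution_ge0. Qed.

Lemma general_solution_X x s : X x -> X (xi x s).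
Proof. by move=> /solP[_ + _ _]; apply; rewrite le_max lexx. Qed.

Lemma general_solution_cont x : X x -> continuous (xi x).
Proof.
move=> /solP[_ _ cx _] s; have D0 u : `[0, +oo[%classic (Num.max 0 u : R).
  by rewrite /= in_itv/= le_max lexx.
move=> B /= ; have /subspace_continuousP/(_ _ (D0 s)) := cx.
move=> /[apply] /= /nbhs_ballP[d /= d0 Hd]; apply/nbhs_ballP; exists d => //= u.
rewrite /ball/= => su; apply: (Hd (Num.max 0 u)) (D0 u); rewrite /ball/=.
apply: le_lt_trans su.
have [s0|s0] := leP 0 s; have [u0|u0] := leP 0 u => //.
- by rewrite subr0 (ger0_norm s0) ger0_norm; lra.
- by rewrite sub0r normrN (ger0_norm u0) ler0_norm; lra.
- by rewrite subrr normr0.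
Qed.

Lemma general_solution_deriv x s : X x -> 0 < s -> {for s, continuous v} ->
  is_derive s (1 : R) (xi x) (F (xi x s) (v s)).
Proof.
move=> /solP[_ _ _ dx] s0 cv; have := dx s s0 cv.
rewrite general_solution_ge0 ?(ltW s0)//.
apply: near_eq_is_derive => //.
near=> u; rewrite general_solution_ge0//; apply: ltW.
by near: u; exact: lt_nbhsr.
Unshelve. all: by end_near. Qed.

End GeneralSolution.

Unset Implicit Arguments.

Theorem mainTheorem5 (R : realType) (n m : nat)
  (X : set 'rV[R]_n) (V : set 'rV[R]_m)
  (F : 'rV[R]_n -> 'rV[R]_m -> 'rV[R]_n)
  (T : R) (U : set (R -> 'rV[R]_m))
  (t r M1 M2 : R) (Omega : set 'rV[R]_n)
  (n_ge2 : (2 <= n)%N)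
  (X_open : open X)
  (F_cont : {within X `*` V, continuous (fun p => F p.1 p.2)})
  (F_C1 : C1_fst X V F)
  (T_gt0 : 0 < T)
  (U_pc : forall u, U u -> piecewise_continuous T V u)
  (F_global : forall x0 v, X x0 -> admissible T U v ->
     exists x, is_solution X F x0 v x)
  (F_C11 : D1_loc_lipschitz X V F)
  (t_gt0 : 0 < t)
  (r_gt0 : 0 < r)
  (Omega_X : Omega `<=` X)
  (Omega_rconvex : r_convex r Omega)
  (Omega_neqT : Omega <> setT)
  (M1_ge : forall x w,
     attainable_tube (general_solution X F) t Omega (admissible T U) x ->
     V w -> 2 * mu_max (D1 F x w) - mu_min (D1 F x w) <= M1)
  (M2_ge : forall x w,
     attainable_tube (general_solution X F) t Omega (admissible T U) x ->
     V w -> (D1_limsup F x w <= M2%:E)%E)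
  (small : r * M2 *
     (\int[lebesgue_measure]_(rho in `[0, t]) expR (M1 * rho)) <= 1) :
  forall tau v, 0 <= tau <= t -> admissible T U v ->
    convex_set [set general_solution X F tau x v | x in Omega].
Proof.
move=> tau v tau_t v_adm.
have /andP[tau0 taut] := tau_t.
have [C OmegaE] := Omega_rconvex.
have C_neq0 : C !=set0.
  apply/set0P/eqP => C0; apply: Omega_neqT.
  by rewrite OmegaE C0 bigcap_set0.
pose xi (x : 'rV[R]_n) (s : R) := general_solution X F (Num.max 0 s) x v.
have xi0 := general_solution0 F_global v_adm.
have xi_X := general_solution_X F_global v_adm.
have xi_cont := general_solution_cont F_global v_adm.
have xi_deriv := general_solution_deriv F_global v_adm.
pose Y := attainable_tube (general_solution X F) t Omega (admissible T U).
have Y_X : Y `<=` X.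
  move=> _ [s [x [u [/andP[s0 _] Ox u_adm ->]]]].
  have := general_solution_X F_global u_adm s (Omega_X _ Ox).
  by rewrite max_r.
have bil x (Xx : X x) := bilip_exists X_open F_C1 T_gt0 U_pc v_adm xi0 xi_X
  xi_cont xi_deriv Xx (ltW t_gt0).
have reach (x : 'rV[R]_n) (k : R) : Omega x -> 0 < k -> exists2 d, 0 < d & forall s (p : 'rV[R]_n),
    0 <= s <= t -> enorm (p - xi x s) < d ->
    exists2 z, enorm (z - x) < k & xi z s = p.
  move=> /Omega_X Xx k0; have [d d0 [K K1 bilx]] := bil x Xx.
  have dk0 : 0 < Num.min d k by rewrite lt_min d0.
  exists (Num.min d k / 2 / (2 * K)).
    by rewrite !divr_gt0// mulr_gt0// (lt_le_trans _ K1).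
  move=> s p st ps.
  have dk : Num.min d k / 2 < Num.min d k by rewrite ltr_pdivrMr// ltr_pMr// ltr1n.
  have dk2 : 0 < Num.min d k / 2 by rewrite divr_gt0.
  have dkd : enorm (x - x) + Num.min d k / 2 < d.
    by rewrite subrr enorm0 add0r (lt_le_trans dk)// ge_min lexx.
  have [z zx xiz] := covers_all xi0 K1 bilx st dk2 dkd ps.
  exists z => //; apply: le_lt_trans zx _; apply: lt_le_trans dk _.
  by rewrite ge_min lexx orbT.
have reach_Y (x : 'rV[R]_n) (k s : R) (z : 'rV[R]_n) : enorm (z - x) < k ->
    (forall y, enorm (y - x) < k -> Omega y) -> 0 <= s <= t -> Y (xi z s).
  move=> zx kO st; exists s, z, v; split=> //; first exact: kO.
  by rewrite /xi max_r//; case/andP: st.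
have small' : r * M2 * exp_primitive M1 t <= 1.
  by rewrite -Rintegral_expR.
move=> _ _ lambda /[!inE] -[x0 Ox0 <-] [x1 Ox1 <-].
have xi_tau x : xi x tau = general_solution X F tau x v by rewrite /xi max_r.
suff [x Ox xE] : exists2 x, (\bigcap_(c in C) eball c r) x &
    xi x tau = xi x1 tau + lambda%:num *: (xi x0 tau - xi x1 tau).
  rewrite -OmegaE in Ox; exists x => //; rewrite -!xi_tau xE.
  by rewrite /conv/= /unstable.onem; apply/rowP => i; rewrite !mxE; ring.
apply: (@image_convex R n r C (fun x => xi x tau)).
- exact: r_gt0.
- exact: C_neq0.
- rewrite -OmegaE => x /Omega_X Xx; have [d d0 [K K1 bilx]] := bil x Xx.
  by apply: (xi_cont_init xi0 K1 bilx); [rewrite subrr enorm0 | exact: tau_t].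
- rewrite -OmegaE => x y Ox Oy.
  exact: (xi_inj X_open F_C1 T_gt0 U_pc v_adm xi0 xi_X xi_cont xi_deriv
    (Omega_X _ Ox) (Omega_X _ Oy) tau_t).
- rewrite -OmegaE => x Ox e e0; have [d d0 Hd] := reach x e Ox e0.
  by exists d => // y; exact: Hd.
- rewrite -OmegaE => x OOx K K1.
  have Ox : Omega x by exact: nbhs_singleton OOx.
  have [k k0 kO] := (nbhs_enormP _ _).1 OOx.
  have [e e0 He] := reach x k Ox k0.
  have Ye s : 0 <= s <= t -> forall p, enorm (p - xi x s) < e -> Y p.
    by move=> st p /(He s p st)[z zx <-]; exact: reach_Y zx kO st.
  have [d d0 Hd] := three_point_estimate X_open F_C1 T_gt0 U_pc v_adm xi0 xi_X
    xi_cont xi_deriv Y_X M1_ge M2_ge (Omega_X _ Ox) e0 tau_t Ye K1.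
  exists d => // z1 z2 z1x z2x mid; apply: le_trans (Hd z1 z2 z1x z2x mid) _.
  rewrite ler_wpM2r ?addr_ge0 ?dot_ge0//.
  rewrite ler_pdivlMr ?mulr_gt0//.
  have -> : K * (M2 / 2) * exp_primitive M1 t * (2 * r) =
      K * (r * M2 * exp_primitive M1 t) by field.
  by rewrite ler_piMr// ltW// (lt_trans _ K1).
- by rewrite -OmegaE.
- by rewrite -OmegaE.
- by rewrite ge0 le1.
Qed.
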